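(* Let $N$ be a positive integer. The symmetry group of the Monge-Ampère equation $$\det D^2u=1,\qquad \forall x\in\mathbb{R}^N,$$ is generated by the following transformations, where $\varepsilon\in\mathbb{R}$ is the group parameter and $i=1,2,\dots,N$: $$\begin{aligned} g^i_1(\varepsilon)&:\ (x,u)\mapsto(\widetilde x,\widetilde u)=(x^1,\dots,x^i+\varepsilon,\dots,x^N,u),\\ g_2(\varepsilon)&:\ (x,u)\mapsto(\widetilde x,\widetilde u)=(x,u+\varepsilon),\\ g^i_3(\varepsilon)&:\ (x,u)\mapsto(\widetilde x,\widetilde u)=(x,u+\varepsilon x^i),\\ g_4(\varepsilon)&:\ (x,u)\mapsto(\widetilde x,\widetilde u)=(A_\varepsilon x,u),\quad A_\varepsilon\in SL(N),\\ g^i_5(\varepsilon)&:\ (x,u)\mapsto(\widetilde x,\widetilde u)=(x^1,\dots,e^{N\varepsilon}x^i,\dots,x^N,e^{2\varepsilon}u). \end{aligned}$$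
   Context: Here $x=(x^1,\dots,x^N)$ are the independent variables, $u$ is the scalar dependent variable, and $D^2u$ is the Hessian matrix of $u$ in $x$. Symmetry group: a symmetry group of a $k$-th order scalar equation $F(x,u,Du,\dots,D^ku)=0$ is a local group of transformations $G$ acting on an open subset $M\subset\{(x,u)\in\mathbb{R}^N\times\mathbb{R}\}$ such that whenever $u=f(x)$ is a solution of the equation (on an open subset of $\mathbb{R}^N$) and $g\circ f$ is defined for $g\in G$, then $u=(g\circ f)(x)$ is also a solution. Here $g\circ f$ denotes the function whose graph is the image under $g$ of the graph of $f$. Infinitesimal form (Lie's theory): a one-parameter group $g(\varepsilon)$ acting on $(x,u)$-space with infinitesimal generator $\vec v=\xi^i(x,u)\frac{\partial}{\partial x^i}+\phi(x,u)\frac{\partial}{\partial u}$ (summation convention) is a one-parameter symmetry group if and only if $pr^{(k)}\vec v\,(F)=0$ at every point $(x,u,Du,\dots,D^ku)$ of the jet space satisfying $F=0$, where the jet coordinates are regarded as independent variables. Here the $k$-th prolongation is $pr^{(k)}\vec v=\vec v+\phi^J\frac{\partial}{\partial u_J}$ (sum over multi-indices $J$ with $1\le|J|\le k$), with $\phi^J=D_J(\phi-\xi^iu_i)+\xi^iD_iu_J$ and $D_J$ the total derivatives. ''The symmetry group'' is the local group generated by all one-parameter symmetry groups, that is, the one corresponding to the Lie algebra of all such infinitesimal generators $\vec v$. In $g_4$, the matrices $A_\varepsilon$ run over the one-parameter subgroups of $SL(N)$.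
   Formalization: For N = 1 the statement fails: u'' = 1 also has the non-affine symmetries (x,u) ↦ (x, e^s u + (1−e^s)x²/2). That the listed transformations generate the whole symmetry group is therefore claimed only for N ≥ 2; that they are symmetries is claimed for all N ≥ 1. *)

(* Defs.v *)
From HB Require Import structures.
From mathcomp Require Import all_boot all_order all_algebra.
From mathcomp Require Import all_classical all_reals all_analysis.

Set Implicit Arguments.
Unset Strict Implicit.
Unset Printing Implicit Defensive.

Import Order.TTheory GRing.Theory Num.Theory.
Import numFieldNormedType.Exports.

Local Open Scope classical_set_scope.
Local Open Scope ring_scope.

(* The space of the variables (x, u); x is a column vector, x^i is [x i 0]. *)
Notation xuspace R N := ('cV[R]_N * R)%type.

(* [iter_derive [:: d1; ...; dk] f] is D_{d1} ... D_{dk} f. *)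
Definition iter_derive (R : realType) (U V : normedModType R)
    (ds : seq U) (f : U -> V) : U -> V :=
  foldr (fun d g => fun z => 'D_d g z) f ds.

(* C^oo on an open set [O]: all iterated directional derivatives exist and are
   continuous at the points of [O]. *)
Definition smooth_on (R : realType) (U V : normedModType R)
    (O : set U) (f : U -> V) : Prop :=
  forall (ds : seq U) (z : U), O z ->
    {for z, continuous (iter_derive ds f)} /\
    forall d : U, derivable (iter_derive ds f) z d.

(** Jet space *)

Definition mindex (N : nat) := {ffun 'I_N -> nat}.

Definition mdeg N (J : mindex N) : nat := (\sum_i J i)%N.

Definition mindex0 N : mindex N := [ffun=> 0%N].

(* J + e_i *)
Definition mincr N (i : 'I_N) (J : mindex N) : mindex N :=
  [ffun j => (J j + (j == i))%N].

(* The multi-indices of degree at most k, each listed once. *)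
Definition mindices (N k : nat) : seq (mindex N) :=
  [seq J <- [seq [ffun i => val (J i)] | J : {ffun 'I_N -> 'I_k.+1}]
     | (mdeg J <= k)%N].

(* A point of the jet space: the x^i, and the u_J for all multi-indices J, as
   independent coordinates; the coordinate u is u_0. A function of
   (x, u, Du, ..., D^k u) is a function on [jet] that only depends on the u_J
   with |J| <= k. *)
Definition jet (R : realType) (N : nat) := ('cV[R]_N * (mindex N -> R))%type.

Section Jets.
Variables (R : realType) (N : nat).
Implicit Types (P F : jet R N -> R) (z : jet R N) (i : 'I_N) (J : mindex N)
  (v : xuspace R N -> xuspace R N).

(* The base point (x, u) of a jet. *)
Definition jbase z : xuspace R N := (z.1, z.2 (mindex0 N)).

Definition partial_x i P : jet R N -> R := fun z =>
  derive1 (fun t : R => P (z.1 + t *: delta_mx i 0, z.2)) 0.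

Definition partial_u J P : jet R N -> R := fun z =>
  derive1
    (fun t : R => P (z.1, fun K => z.2 K + (if K == J then t else 0))) 0.

(* D_i P = dP/dx^i + sum_J u_{J+e_i} dP/du_J, for P of order at most k. *)
Definition total_D (k : nat) i P : jet R N -> R := fun z =>
  partial_x i P z +
  \sum_(J <- mindices N k) z.2 (mincr i J) * partial_u J P z.

(* D_J = D_1^{J_1} ... D_N^{J_N}. The truncation order k is adequate as soon as
   P has order m with m + |J| <= k + 1, since the last D_i is then applied to a
   function of order at most k. *)
Definition total_DJ (k : nat) J P : jet R N -> R :=
  foldr (fun i Q => iter (J i) (total_D k i) Q) P (enum 'I_N).

(* For a vector field v = xi^i d/dx^i + phi d/du on (x,u)-space, given as
   the map (x, u) |-> (xi(x, u), phi(x, u)). *)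
Definition xi_of v i : jet R N -> R := fun z => (v (jbase z)).1 i 0.
Definition phi_of v : jet R N -> R := fun z => (v (jbase z)).2.

(* phi^J = D_J (phi - xi^i u_i) + xi^i D_i u_J. For |J| <= k the truncation
   order k is adequate: phi - xi^i u_i has order 1. *)
Definition prolong_coef (k : nat) v J : jet R N -> R := fun z =>
  total_DJ k J
    (fun y => phi_of v y - \sum_i xi_of v i y * y.2 (mincr i (mindex0 N))) z
  + \sum_i xi_of v i z * total_D k i (fun y => y.2 J) z.

(* (pr^(k) v) F *)
Definition prolong (k : nat) v F : jet R N -> R := fun z =>
  \sum_i xi_of v i z * partial_x i F z
  + phi_of v z * partial_u (mindex0 N) F z
  + \sum_(J <- mindices N k | (0 < mdeg J)%N)
      prolong_coef k v J z * partial_u J F z.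

(* Lie's criterion on M for the equation F(x, u, Du, ..., D^k u) = 0. *)
Definition symmetry_generator (k : nat) F (M : set (xuspace R N)) v : Prop :=
  forall z, M (jbase z) -> F z = 0 -> prolong k v F z = 0.

End Jets.

(** Local groups of transformations of (x,u)-space *)

(* A one-parameter family of transformations: [act G e p] is meaningful for
   (e, p) in [dom G]. *)
Record oneparam (R : realType) (N : nat) := OneParam {
  dom : set (R * xuspace R N);
  act : R -> xuspace R N -> xuspace R N }.

Section Groups.
Variables (R : realType) (N : nat).
Implicit Types (G : oneparam R N) (p : xuspace R N).

(* The open set acted upon. *)
Definition carrier G : set (xuspace R N) := [set p | dom G (0, p)].

(* G is a smooth local action of the additive group R on [carrier G], with
   each transformation orbit parametrized by an interval. *)
Record local_action G : Prop := LocalAction {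
  dom_open : open (dom G);
  dom_interval : forall p, is_interval [set e | dom G (e, p)];
  dom_carrier : forall e p, dom G (e, p) ->
    carrier G p /\ carrier G (act G e p);
  act_smooth : smooth_on (dom G) (fun z => act G z.1 z.2);
  act0 : forall p, carrier G p -> act G 0 p = p;
  actD : forall d e p, dom G (e, p) -> dom G (d, act G e p) ->
    dom G (d + e, p) -> act G d (act G e p) = act G (d + e) p;
  dom_inv : forall e p, dom G (e, p) -> dom G (- e, act G e p) }.

Definition generator G : xuspace R N -> xuspace R N := fun p =>
  derive1 (fun e : R => act G e p) 0.

Definition oneparam_symmetry (k : nat) (F : jet R N -> R) G : Prop :=
  local_action G /\ symmetry_generator k F (carrier G) (generator G).

(* The local group generated by a family S of one-parameter local groups:
   [local_group S p T] says that the transformation T coincides near p with a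
   finite composition of transformations of members of S. Inverses are
   included, e being of any sign. *)
Inductive local_group (S : oneparam R N -> Prop) p :
    (xuspace R N -> xuspace R N) -> Prop :=
| local_group_id T :
    (\forall q \near p, T q = q) -> local_group S p T
| local_group_comp G e T T' :
    S G -> local_group S p T -> dom G (e, T p) ->
    (\forall q \near p, T' q = act G e (T q)) -> local_group S p T'.

Definition symmetry_group (k : nat) (F : jet R N -> R) :=
  local_group (oneparam_symmetry k F).

(** The Monge-Ampere equation *)

Definition jet_hessian (z : jet R N) : 'M[R]_N :=
  \matrix_(i, j) z.2 (mincr i (mincr j (mindex0 N))).

Definition monge_ampere (z : jet R N) : R := \det (jet_hessian z) - 1.

Definition SL_oneparam_subgroup (A : R -> 'M[R]_N) : Prop :=
  [/\ smooth_on setT A,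
      forall d e, A (d + e) = A d *m A e &
      forall e, \det (A e) = 1].

Definition global_oneparam (a : R -> xuspace R N -> xuspace R N) :
  oneparam R N := OneParam setT a.

Inductive MA_transformations : oneparam R N -> Prop :=
| MA_g1 (i : 'I_N) : MA_transformations (global_oneparam
    (fun e p => (p.1 + e *: delta_mx i 0, p.2)))
| MA_g2 : MA_transformations (global_oneparam
    (fun e p => (p.1, p.2 + e)))
| MA_g3 (i : 'I_N) : MA_transformations (global_oneparam
    (fun e p => (p.1, p.2 + e * p.1 i 0)))
| MA_g4 (A : R -> 'M[R]_N) : SL_oneparam_subgroup A ->
    MA_transformations (global_oneparam
    (fun e p => (A e *m p.1, p.2)))
| MA_g5 (i : 'I_N) : MA_transformations (global_oneparam
    (fun e p => (\col_j (if j == i then expR (N%:R * e) * p.1 j 0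
                         else p.1 j 0),
                 expR (2 * e) * p.2))).

End Groups.

Arguments monge_ampere R N z : clear implicits.
Arguments MA_transformations R N : clear implicits.

(* Main.v *)
Require Import Defs.
From HB Require Import structures.
From mathcomp Require Import all_boot all_order all_algebra.
From mathcomp Require Import all_classical all_reals all_analysis.
From mathcomp Require Import perm ring lra.
Import Order.TTheory GRing.Theory Num.Theory.
Import numFieldNormedType.Exports.
Set Implicit Arguments.
Unset Strict Implicit.
Unset Printing Implicit Defensive.
Local Open Scope classical_set_scope.
Local Open Scope ring_scope.

(* Where det D^2 u = 1, the cofactor matrix C of the Hessian is its inverse, so
   all derivatives of u of order at least 2 drop out when the prolongation of
   v = xi^i d/dx^i + phi d/du is applied to the equation, except through C:

     sum_ab C_ab (T_ab phi - u_i T_ab xi^i)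
       + N (phi_u - xi^i_u u_i) - 2 (xi^i_i + xi^i_u u_i) = 0,

   T_ab f = f_ab + u_a f_bu + u_b f_au + u_a u_b f_uu. For N > 1, the choice
   C = P P^T with P = 1 + s E_ab shows that the coefficient of every C_ab and
   the remaining constant vanish separately. As polynomials in the u_i these
   equations give xi_u = 0, N phi_u = 2 div xi, and that all the second
   derivatives of xi and phi are 0: v is locally an affine vector field.

   The flow of such a v is affine as well, by uniqueness for linear differential
   equations: (x, u) |-> (A x + b, m u + c x + d), where Liouville's formula and
   N phi_u = 2 div xi give m > 0, det A > 0 and (det A)^2 = m^N. These relations
   are stable under composition, and the connectedness of the time interval
   extends the local statement to the whole orbit. Finally, a map of this form
   is a composition of the listed transformations, because SL(N) is generated by
   transvections. *)

(** * Directional derivatives and smooth functions *)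

(** Smoothness is given only through iterated directional derivatives, without total
    differentiability. Additivity in the direction, symmetry of mixed derivatives and exact Taylor
    expansions are therefore all drawn from the one-variable mean value theorem along lines, using
    continuity of the derivatives.

    The flow is part of the data, so no existence theorem and no matrix exponential enter. The
    candidate linear part is read off N + 1 trajectories of the flow itself, and uniqueness
    identifies all other trajectories with it.

    The relation (det A)^2 = m^N is the integrated form of N phi_u = 2 div xi. It is exactly what
    allows a single use of g5 to normalize both m and det A, leaving a matrix of SL(N). *)

Section DirectionalDerivatives.
Variable R : realType.
Implicit Types V W : normedModType R.

(** A directional derivative depends only on the restriction to a line, so it can be moved between
    functions on different spaces whose restrictions agree. *)
Lemma is_derive_transport V V' W (f : V -> W) (g : V' -> W) a v b w l :
  (forall h : R, f (h *: v + a) = g (h *: w + b)) ->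
  is_derive a v f l -> is_derive b w g l.
Proof.
move=> fg [df <-].
have fg0 : f a = g b by have := fg 0; rewrite !scale0r !add0r.
have E : (fun h : R => h^-1 *: ((f \o shift a) (h *: v) - f a)) =
    (fun h : R => h^-1 *: ((g \o shift b) (h *: w) - g b)).
  by rewrite funeqE => h /=; rewrite fg fg0.
by split; rewrite /derivable /derive -E.
Qed.

Lemma is_derive_line V W (f : V -> W) x v t l :
  is_derive (x + t *: v) v f l -> is_derive t (1 : R) (fun s : R => f (x + s *: v)) l.
Proof.
apply: is_derive_transport => h.
by rewrite [h *: 1]mulr1 scalerDl addrCA.
Qed.

Lemma line_is_derive V W (f : V -> W) x v l :
  is_derive (0 : R) 1 (fun s : R => f (x + s *: v)) l -> is_derive x v f l.
Proof.
by apply: is_derive_transport => h; rewrite [h *: 1]mulr1 addr0 addrC.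
Qed.

Lemma is_derive_linear V W W' (l : {linear W -> W'}) (f : V -> W) a v df :
  continuous l -> is_derive a v f df -> is_derive a v (l \o f) (l df).
Proof.
move=> lc [+ <-] => /cvg_ex[k fk].
have -> : 'D_v f a = k by exact: cvg_lim fk.
have E : (fun h : R => h^-1 *: (((l \o f) \o shift a) (h *: v) - (l \o f) a)) @ 0^'
    --> l k.
  have -> : (fun h : R => h^-1 *: (((l \o f) \o shift a) (h *: v) - (l \o f) a)) =
    l \o (fun h : R => h^-1 *: ((f \o shift a) (h *: v) - f a)).
    by rewrite funeqE => h /=; rewrite [l (_ *: _)]linearZ /= [l (_ - _)]linearB.
  exact: (cvg_comp _ _ fk (lc k)).
split; first by apply/cvg_ex; exists (l k).
exact: cvg_lim E.
Qed.

Lemma is_derive_linear_apply V W W' (l : W -> W') (f : V -> W) a v df :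
  linear l -> continuous l -> is_derive a v f df ->
  is_derive a v (fun x => l (f x)) (l df).
Proof.
move=> ll; pose lM := GRing.isLinear.Build _ _ _ _ _ ll.
pose L : {linear _ -> _} := HB.pack l lM.
rewrite -[l]/(L : W -> W'); exact: is_derive_linear.
Qed.

Lemma is_derive_fst V W W' (f : V -> (W * W')%type) a v df :
  is_derive a v f df -> is_derive a v (fun x => (f x).1) df.1.
Proof. by apply: is_derive_linear_apply => [k x y|x]; [|exact: cvg_fst]. Qed.

Lemma is_derive_snd V W W' (f : V -> (W * W')%type) a v df :
  is_derive a v f df -> is_derive a v (fun x => (f x).2) df.2.
Proof. by apply: is_derive_linear_apply => [k x y|x]; [|exact: cvg_snd]. Qed.

Lemma is_derive_coord V m n (f : V -> 'M[R]_(m, n)) a v df i j :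
  is_derive a v f df -> is_derive a v (fun x => f x i j) (df i j).
Proof.
apply: (@is_derive_linear_apply _ 'M[R]_(m, n) R (fun M => M i j)) => [k x y|x].
  by rewrite !mxE.
exact: coord_continuous.
Qed.

Lemma is_derive_add V W (f g : V -> W) a v df dg :
  is_derive a v f df -> is_derive a v g dg ->
  is_derive a v (fun x => f x + g x) (df + dg).
Proof. exact: is_deriveD. Qed.

Lemma is_derive_sub V W (f g : V -> W) a v df dg :
  is_derive a v f df -> is_derive a v g dg ->
  is_derive a v (fun x => f x - g x) (df - dg).
Proof. exact: is_deriveB. Qed.

Lemma is_derive_mul V (f g : V -> R) a v df dg :
  is_derive a v f df -> is_derive a v g dg ->
  is_derive a v (fun x => f x * g x) (f a * dg + df * g a).
Proof.
move=> Hf Hg; have /is_derive_eq := is_deriveM Hf Hg; apply.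
by rewrite [df * _]mulrC.
Qed.

Lemma is_derive_bigsum V W I (r : seq I) (P : pred I) (h : I -> V -> W) a v
    (dh : I -> W) :
  (forall i, P i -> is_derive a v (h i) (dh i)) ->
  is_derive a v (fun x => \sum_(i <- r | P i) h i x) (\sum_(i <- r | P i) dh i).
Proof.
move=> Hh.
rewrite (_ : (fun x => _) = \sum_(i <- r | P i) h i); last first.
  by rewrite funeqE => x; rewrite fct_sumE.
elim/big_ind2 : _ => // [|f df g dg]; first exact: is_derive_cst.
exact: is_deriveD.
Qed.

(** Without total differentiability, homogeneity in the direction comes from reparametrizing the
    line by [s * k]; this covers [k = 0] too. *)
Lemma is_derive_scale V (f : V -> R) x v k l :
  is_derive x v f l -> is_derive x (k *: v) f (k * l).
Proof.
move=> Hf; apply: line_is_derive.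
have H1 : is_derive (0 * k : R) 1 (fun s : R => f (x + s *: v)) l.
  by apply: is_derive_line; rewrite mul0r scale0r addr0.
have H2 : is_derive (0 : R) 1 (fun s : R => s * k) k.
  have := is_derive_mul (is_derive_id (0 : R) 1) (is_derive_cst k (0 : R) 1).
  by rewrite mul0r add0r mul1r.
have := @is_derive1_comp R (fun s => f (x + s *: v)) (fun s => s * k) 0 _ _ H1 H2.
rewrite mulrC.
by congr is_derive; rewrite funeqE => s /=; rewrite scalerA.
Qed.

Lemma is_derive_linear_fun V W (l : {linear V -> W}) a v :
  continuous l -> is_derive a v l (l v).
Proof.
move=> lc; have := is_derive_linear lc (is_derive_id a v).
by congr is_derive; rewrite funeqE.
Qed.

Lemma near_is_derive V W (O : set V) (f g : V -> W) a v l :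
  open O -> (forall x, O x -> f x = g x) -> O a ->
  is_derive a v f l -> is_derive a v g l.
Proof.
move=> Oo fg Oa; apply: near_eq_is_derive.
by apply: filterS (open_nbhs_nbhs (conj Oo Oa)) => x /fg.
Qed.

(** The segment is parametrized over [0, 1] instead of [0, h], so [h] may have any sign. *)
Lemma MVT_direction V (f g : V -> R) z d (h : R) :
  (forall s : R, 0 <= s <= 1 ->
    is_derive (z + (s * h) *: d) d f (g (z + (s * h) *: d))) ->
  exists2 s, 0 <= s <= 1 & f (z + h *: d) - f z = h * g (z + (s * h) *: d).
Proof.
move=> Hf.
have HF (s : R) : 0 <= s <= 1 -> is_derive s (1 : R) (fun s : R => f (z + s *: (h *: d)))
    (h * g (z + (s * h) *: d)).
  move=> s01; apply: is_derive_line; rewrite scalerA.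
  by apply: is_derive_scale; exact: Hf.
have [||s s01] := @MVT_segment R (fun s : R => f (z + s *: (h *: d)))
    (fun s => h * g (z + (s * h) *: d)) 0 1 ler01.
- by move=> s; rewrite in_itv /= => /andP[s0 s1]; apply: HF; rewrite !ltW.
- apply: derivable_within_continuous => s; rewrite in_itv /= => s01.
  by have [] := HF s s01.
- rewrite scale1r scale0r addr0 subr0 mulr1 => E.
  by exists s.
Qed.

Lemma small_scale_in_ball (h : R) V (d e : V) (r : R) (s t : R) :
  0 < r -> `|h| < r / (`|d| + `|e| + 1) -> 0 <= s <= 1 -> 0 <= t <= 1 ->
  `|(s * h) *: d + (t * h) *: e| < r.
Proof.
move=> r0 hr /andP[s0 s1] /andP[t0 t1].
apply: le_lt_trans (ler_normD _ _) _; rewrite !normrZ (ger0_norm s0) (ger0_norm t0).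
have Hp : 0 < `|d| + `|e| + 1 by rewrite ltr_wpDl // addr_ge0.
move: hr; rewrite ltr_pdivlMr // => hr.
apply: le_lt_trans hr.
rewrite !mulrDr mulr1 -[leLHS]addr0 lerD// lerD //.
  by rewrite ler_wpM2r // ler_piMl.
by rewrite ler_wpM2r // ler_piMl.
Qed.

(** Split the increment into a step along [d] and a step along [e]. The second starts at a moving
    point, so the mean value theorem and the continuity of [g] are what give its limit. *)
Lemma is_derive_dirD V (O : set V) (f g k : V -> R) z d e :
  open O -> O z -> is_derive z d f (k z) ->
  (forall y, O y -> is_derive y e f (g y)) -> {for z, continuous g} ->
  is_derive z (d + e) f (k z + g z).
Proof.
move=> Oo Oz Hk Hg gc.
have C : (fun h : R => h^-1 *: ((f \o shift z) (h *: (d + e)) - f z)) @ 0^'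
    --> k z + g z.
  have [kd <-] := Hk.
  rewrite (_ : (fun h : R => _) = (fun h : R =>
      h^-1 *: ((f \o shift z) (h *: d) - f z) +
      h^-1 *: (f (z + h *: d + h *: e) - f (z + h *: d)))); last first.
    rewrite funeqE => h /=; rewrite -scalerDr; congr (_ *: _).
    rewrite [h *: d + z]addrC [RHS]addrC addrA subrK scalerDr.
    by rewrite [_ + z]addrC addrA.
  apply: cvgD => //.
  apply/cvgrPdist_le => /= eps eps0.
  have /nbhs_normP[r /= r0 Hr] : \forall y \near z, O y /\ `|g z - g y| <= eps.
    apply: filterI; first exact: open_nbhs_nbhs.
    by move/cvgrPdist_le : gc; apply.
  have Hin (s t h : R) : `|h| < r / (`|d| + `|e| + 1) -> 0 <= s <= 1 -> 0 <= t <= 1 ->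
      O (z + (s * h) *: d + (t * h) *: e) /\
      `|g z - g (z + (s * h) *: d + (t * h) *: e)| <= eps.
    move=> hr s01 t01; apply: Hr => /=; rewrite -addrA opprD addNKr normrN.
    exact: (@small_scale_in_ball h).
  have i1 : 0 <= (1 : R) <= 1 by rewrite ler01 lexx.
  near=> h.
  have hr : `|h| < r / (`|d| + `|e| + 1).
    near: h; apply: dnbhs0_lt; rewrite divr_gt0 // ltr_wpDl // addr_ge0 //.
  have h0 : h != 0 by near: h; exact: nbhs_dnbhs_neq.
  have [|t t01 ->] := @MVT_direction V f g (z + h *: d) e h.
    move=> t t01; apply: Hg.
    by have := (Hin 1 t h hr i1 t01).1; rewrite mul1r.
  rewrite [_ *: (_ * _)]mulrA mulVf // mul1r.
  by have := (Hin 1 t h hr i1 t01).2; rewrite mul1r.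
split; first by apply/cvg_ex; exists (k z + g z).
exact: cvg_lim C.
Unshelve. all: by end_near. Qed.

(** Two applications of the mean value theorem turn the second difference into exactly [h * h] times
    a value of [fed] near [z]. *)
Lemma second_difference V (O : set V) (f fd fed : V -> R) z d e :
  open O -> O z ->
  (forall y, O y -> is_derive y d f (fd y)) ->
  (forall y, O y -> is_derive y e fd (fed y)) -> {for z, continuous fed} ->
  forall eps, 0 < eps -> \forall h \near 0^',
   `|fed z - (h * h)^-1 *
      (f (z + h *: d + h *: e) - f (z + h *: d) - f (z + h *: e) + f z)| <= eps.
Proof.
move=> Oo Oz Hd Hed fc eps eps0.
have /nbhs_normP[r /= r0 Hr] : \forall y \near z, O y /\ `|fed z - fed y| <= eps.
  apply: filterI; first exact: open_nbhs_nbhs.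
  by move/cvgrPdist_le : fc; apply.
have Hin (s t h : R) : `|h| < r / (`|d| + `|e| + 1) -> 0 <= s <= 1 -> 0 <= t <= 1 ->
    O (z + (s * h) *: d + (t * h) *: e) /\
    `|fed z - fed (z + (s * h) *: d + (t * h) *: e)| <= eps.
  move=> hr s01 t01; apply: Hr => /=; rewrite -addrA opprD addNKr normrN.
  exact: (@small_scale_in_ball h).
have i1 : 0 <= (1 : R) <= 1 by rewrite ler01 lexx.
have i0 : 0 <= (0 : R) <= 1 by rewrite ler01 lexx.
near=> h.
have hr : `|h| < r / (`|d| + `|e| + 1).
  near: h; apply: dnbhs0_lt; rewrite divr_gt0 // ltr_wpDl // addr_ge0 //.
have h0 : h != 0 by near: h; exact: nbhs_dnbhs_neq.
have [|s s01 E1] := @MVT_direction V (fun y => f (y + h *: e) - f y)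
    (fun y => fd (y + h *: e) - fd y) z d h.
  move=> s s01; apply: is_derive_sub; last first.
    apply: Hd.
    by have := (Hin s 0 h hr s01 i0).1; rewrite mul0r scale0r addr0.
  have : is_derive (z + (s * h) *: d + h *: e) d f
     (fd (z + (s * h) *: d + h *: e)).
    by apply: Hd; have := (Hin s 1 h hr s01 i1).1; rewrite mul1r.
  by apply: is_derive_transport => u; rewrite addrA.
have [|t t01 E2] := @MVT_direction V fd fed (z + (s * h) *: d) e h.
  by move=> t t01; apply: Hed; have := (Hin s t h hr s01 t01).1.
rewrite E2 in E1.
suff -> : (h * h)^-1 *
      (f (z + h *: d + h *: e) - f (z + h *: d) - f (z + h *: e) + f z) =
      fed (z + (s * h) *: d + (t * h) *: e).
  by have := (Hin s t h hr s01 t01).2.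
have -> : f (z + h *: d + h *: e) - f (z + h *: d) - f (z + h *: e) + f z =
  h * (h * fed (z + (s * h) *: d + (t * h) *: e)) by rewrite -E1; ring.
by field.
Unshelve. all: by end_near. Qed.

(** The second difference is symmetric in [d] and [e], so both mixed derivatives are limits of the
    same quotient. *)
Lemma Schwarz V (O : set V) (f fd fe fed fde : V -> R) z d e :
  open O -> O z ->
  (forall y, O y -> is_derive y d f (fd y)) ->
  (forall y, O y -> is_derive y e f (fe y)) ->
  (forall y, O y -> is_derive y e fd (fed y)) ->
  (forall y, O y -> is_derive y d fe (fde y)) ->
  {for z, continuous fed} -> {for z, continuous fde} -> fed z = fde z.
Proof.
move=> Oo Oz Hd He Hed Hde ced cde.
apply/eqP; rewrite -subr_eq0 -normr_le0; apply/ler_addgt0Pr => eps eps0.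
rewrite add0r.
have e2 : 0 < eps / 2 by rewrite divr_gt0.
have H1 := second_difference Oo Oz Hd Hed ced e2.
have H2 := second_difference Oo Oz He Hde cde e2.
have [h [h1 h2]] := filter_ex (filterI H1 H2).
move: h2; rewrite (_ : f _ - _ - _ + _ =
  f (z + h *: d + h *: e) - f (z + h *: d) - f (z + h *: e) + f z); last first.
  by rewrite addrAC [z + h *: e + h *: d]addrAC; ring.
set X := _^-1 * _ in h1 *; move=> h2.
rewrite [eps]splitr (_ : fed z - fde z = (fed z - X) + (X - fde z)); last by ring.
apply: le_trans (ler_normD _ _) _; apply: lerD => //.
by rewrite distrC.
Qed.

Lemma is_derive_expR_line (k t : R) :
  is_derive t (1 : R) (fun e => expR (k * e)) (k * expR (k * t)).
Proof.
rewrite mulrC; apply: (@is_derive1_comp _ expR ( *%R k)).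
by have := is_deriveZ k (is_derive_id t (1 : R)); rewrite [_ *: 1]mulr1.
Qed.

Lemma continuous_pairl V W (a : V) (q : W) : {for q, continuous (fun q => (a, q))}.
Proof.
exact: (@cvg_pair _ _ _ (nbhs q) (nbhs a) (nbhs q) _ _ _ (fun=> a) id
  (cvg_cst _) cvg_id).
Qed.

Lemma continuous_pairr V W (a : V) (q : W) : {for a, continuous (fun a => (a, q))}.
Proof.
exact: (@cvg_pair _ _ _ (nbhs a) (nbhs a) (nbhs q) _ _ _ id (fun=> q)
  cvg_id (cvg_cst _)).
Qed.

End DirectionalDerivatives.

(** * Closure properties of smooth functions *)

Section Smooth.
Variable R : realType.
Implicit Types U V W : normedModType R.

Lemma smooth_continuous U V (O : set U) (f : U -> V) z :
  smooth_on O f -> O z -> {for z, continuous f}.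
Proof. by move=> fs Oz; have [] := fs [::] z Oz. Qed.

Lemma smooth_is_derive U V (O : set U) (f : U -> V) z d :
  smooth_on O f -> O z -> is_derive z d f ('D_d f z).
Proof. by move=> fs Oz; have [_ /(_ d)] := fs [::] z Oz; exact: derivableP. Qed.

Lemma smooth_derive U V (O : set U) (f : U -> V) d :
  smooth_on O f -> smooth_on O ('D_d f).
Proof.
by move=> fs ds z Oz; have := fs (rcons ds d) z Oz; rewrite /iter_derive foldr_rcons.
Qed.

(** Coinduction principle: a class of functions continuous on [O] and closed under directional
    derivatives there contains, up to equality on [O], every iterated derivative of its members.
    Each later smoothness proof exhibits such a class. *)
Lemma smooth_coind U V (O : set U) (C : (U -> V) -> Prop) : open O ->
  (forall f z, C f -> O z -> {for z, continuous f}) ->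
  (forall f d, C f ->
    exists2 g, C g & forall z, O z -> is_derive z d f (g z)) ->
  forall f, C f -> smooth_on O f.
Proof.
move=> Oo Cc Cd f Cf.
have H ds : exists2 g, C g & forall z, O z -> g z = iter_derive ds f z.
  elim: ds => [|d ds [g Cg gE]]; first by exists f.
  have [k Ck kE] := Cd g d Cg; exists k => // z Oz /=.
  by have [_ <-] := near_is_derive Oo gE Oz (kE z Oz).
move=> ds z Oz; have [g Cg gE] := H ds.
split.
  have near_gE : \forall y \near z, g y = iter_derive ds f y.
    by apply: filterS (open_nbhs_nbhs (conj Oo Oz)) => y /gE.
  rewrite /prop_for /continuous_at -(gE z Oz).
  apply: cvg_trans (Cc g z Cg Oz).
  by apply: near_eq_cvg.
move=> d; have [k _ kE] := Cd g d Cg.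
by have [] := near_is_derive Oo gE Oz (kE z Oz).
Qed.

Lemma smooth_linear U V W (O : set U) (l : {linear V -> W}) (f : U -> V) :
  open O -> continuous l -> smooth_on O f -> smooth_on O (fun x => l (f x)).
Proof.
move=> Oo lc fs.
apply: (@smooth_coind U W O (fun g => exists2 f, smooth_on O f & g = l \o f)).
- exact: Oo.
- move=> _ z [g gs ->] Oz; apply: continuous_comp.
    exact: smooth_continuous gs Oz.
  exact: lc.
- move=> _ d [g gs ->]; exists (l \o 'D_d g).
    by exists ('D_d g) => //; exact: smooth_derive.
  by move=> z Oz; apply: is_derive_linear => //; exact: smooth_is_derive gs Oz.
- by exists f.
Qed.

Lemma smooth_slice U V (O : set (R * U)) (F : R * U -> V) : open O ->
  smooth_on O F -> smooth_on [set p | O (0, p)] (fun p => F (0, p)).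
Proof.
move=> Oo Fs.
apply: (@smooth_coind U V _
  (fun g => exists2 F, smooth_on O F & g = fun p => F (0, p))).
- by apply: open_comp => // p _; exact: continuous_pairl.
- move=> _ z [g gs ->] /= Oz.
  apply: (@continuous_comp _ _ _ (fun p : U => (0 : R, p)) g);
    first exact: continuous_pairl.
  exact: smooth_continuous gs Oz.
- move=> _ d [g gs ->]; exists (fun p => 'D_((0, d) : R * U) g (0, p)).
    by exists ('D_((0, d) : R * U) g) => //; exact: smooth_derive.
  move=> z /= Oz; have := smooth_is_derive ((0, d) : R * U) gs Oz.
  apply: is_derive_transport => h; congr g; congr pair => /=.
  by rewrite scaler0 addr0.
- by exists F.
Qed.

Lemma smooth_cst U V (w : V) : smooth_on setT (fun _ : U => w).
Proof.
apply: (@smooth_coind U V _ (fun g => exists w, g = cst w)).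
- exact: openT.
- by move=> _ z [k ->] _; exact: cvg_cst.
- by move=> _ d [k ->]; exists (cst 0); [exists 0 | move=> z _; exact: is_derive_cst].
- by exists w.
Qed.

Lemma smooth_add U V (O : set U) (f g : U -> V) : open O ->
  smooth_on O f -> smooth_on O g -> smooth_on O (fun x => f x + g x).
Proof.
move=> Oo fs gs.
apply: (@smooth_coind U V _ (fun h => exists f g,
   [/\ smooth_on O f, smooth_on O g & h = fun x => f x + g x])) => //.
- move=> _ z [a [b [sa sb ->]]] Oz.
  by apply: cvgD; [exact: smooth_continuous sa Oz | exact: smooth_continuous sb Oz].
- move=> _ d [a [b [sa sb ->]]]; exists (fun x => 'D_d a x + 'D_d b x).
    by exists ('D_d a), ('D_d b); split => //; exact: smooth_derive.
  move=> z Oz; apply: is_derive_add.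
    exact: smooth_is_derive sa Oz.
  exact: smooth_is_derive sb Oz.
- by exists f, g.
Qed.

Lemma smooth_sum U V I (r : seq I) (f : I -> U -> V) :
  (forall i, smooth_on setT (f i)) -> smooth_on setT (fun x => \sum_(i <- r) f i x).
Proof.
move=> fs; elim: r => [|i r IH].
  under eq_fun do rewrite big_nil.
  exact: smooth_cst.
under eq_fun do rewrite big_cons.
by apply: smooth_add => //; exact: openT.
Qed.

(** Products of two smooth functions are not closed under derivation, since the Leibniz rule creates
    sums; the generated algebra is. *)
Inductive smooth_algebra U : (U -> R) -> Prop :=
| smooth_algebra_smooth f : smooth_on setT f -> smooth_algebra f
| smooth_algebra_add f g : smooth_algebra f -> smooth_algebra g ->
    smooth_algebra (fun x => f x + g x)
| smooth_algebra_mul f g : smooth_algebra f -> smooth_algebra g ->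
    smooth_algebra (fun x => f x * g x).

Lemma smooth_mul U (f g : U -> R) :
  smooth_on setT f -> smooth_on setT g -> smooth_on setT (fun x => f x * g x).
Proof.
move=> fs gs; apply: (@smooth_coind U R _ (@smooth_algebra U)).
- exact: openT.
- move=> h z; elim=> {h}[h hs|h k _ IH _ IK|h k _ IH _ IK] Oz.
  + exact: smooth_continuous hs Oz.
  + by apply: cvgD; [exact: IH | exact: IK].
  + by apply: cvgM; [exact: IH | exact: IK].
- move=> h d; elim=> {h}[h hs|h k sh [h' sh' h'E] sk [k' sk' k'E]
      |h k sh [h' sh' h'E] sk [k' sk' k'E]].
  + exists ('D_d h); first by apply: smooth_algebra_smooth; exact: smooth_derive.
    by move=> z; exact: smooth_is_derive.
  + exists (fun x => h' x + k' x); first exact: smooth_algebra_add.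
    by move=> z Oz; apply: is_derive_add; [exact: h'E | exact: k'E].
  + exists (fun x => h x * k' x + h' x * k x).
      by apply: smooth_algebra_add; exact: smooth_algebra_mul.
    by move=> z Oz; apply: is_derive_mul; [exact: h'E | exact: k'E].
- by apply: smooth_algebra_mul; exact: smooth_algebra_smooth.
Qed.

Lemma smooth_comp_linear U V (l : {linear U -> R}) (g : R -> V) :
  continuous l -> smooth_on setT g -> smooth_on setT (fun z => g (l z)).
Proof.
move=> lc gs.
apply: (@smooth_coind U V setT (fun h => exists k g,
   smooth_on setT g /\ h = fun z : U => k *: g (l z))).
- exact: openT.
- move=> _ z [k [h [hs ->]]] _.
  apply: cvgZr; apply: (@continuous_comp _ _ _ l h); first exact: lc.
  exact: smooth_continuous hs _.
- move=> _ d [k [h [hs ->]]].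
  exists (fun z : U => (k * l d) *: 'D_(1 : R) h (l z)).
    by exists (k * l d), ('D_(1 : R) h); split => //; exact: smooth_derive.
  move=> z _; rewrite -scalerA; apply: is_deriveZ.
  have H : is_derive (l z) 1 h ('D_(1 : R) h (l z)).
    exact: (smooth_is_derive _ hs).
  apply: line_is_derive.
  (* In one variable derivability is total differentiability, so the usual chain rule applies once
     [l] is restricted to the line. *)
  have hd : differentiable h (l (z + 0 *: d)).
    rewrite scale0r addr0; apply/derivable1_diffP.
    by have [] := H.
  have ld : is_derive (0 : R) 1 (fun s : R => l (z + s *: d)) (l d).
    by apply: is_derive_line; exact: is_derive_linear_fun.
  have ld' : differentiable (fun s : R => l (z + s *: d)) (0 : R).
    by apply/derivable1_diffP; have [] := ld.
  split.
    apply/derivable1_diffP.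
    exact: (@differentiable_comp _ _ _ _ (fun s : R => l (z + s *: d)) h).
  rewrite deriveE; last first.
    exact: (@differentiable_comp _ _ _ _ (fun s : R => l (z + s *: d)) h).
  rewrite (@diff_comp _ _ _ _ (fun s : R => l (z + s *: d)) h) //=.
  rewrite -!deriveE // derive_val scale0r addr0 -[X in 'D_X _ _]mulr1.
  rewrite deriveE ?linearZ -?deriveE //.
    by have [] := H; rewrite -derivable1_diffP.
  by have [] := H; rewrite -derivable1_diffP.
- by exists 1, g; split => //; rewrite funeqE => z; rewrite scale1r.
Qed.

Lemma smooth_exp (c : R) : smooth_on setT (fun t : R => expR (c * t)).
Proof.
apply: (@smooth_coind R R setT (fun h => exists k, h = fun t : R => k * expR (c * t))).
- exact: openT.
- move=> _ z [k ->] _; apply: cvgM; first exact: cvg_cst.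
  apply: (@continuous_comp _ _ _ ( *%R c) expR); last exact: continuous_expR.
  exact: mulrl_continuous.
- move=> _ d [k ->]; exists (fun t => d * k * c * expR (c * t)).
    by exists (d * k * c).
  move=> z _; rewrite -[X in is_derive _ X]mulr1.
  rewrite (_ : d * k * c * _ = d * (k * (c * expR (c * z)))); last by ring.
  by apply: is_derive_scale; apply: is_deriveZ; exact: is_derive_expR_line.
- by exists 1; rewrite funeqE => t; rewrite mul1r.
Qed.

Lemma smooth_linear_apply U V W (O : set U) (l : V -> W) (f : U -> V) :
  linear l -> continuous l -> open O -> smooth_on O f ->
  smooth_on O (fun x => l (f x)).
Proof.
move=> ll; pose lM := GRing.isLinear.Build _ _ _ _ _ ll.
pose L : {linear _ -> _} := HB.pack l lM.
rewrite -[l]/(L : V -> W) => lc Oo; exact: smooth_linear.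
Qed.

Lemma smooth_fst U V W (O : set U) (f : U -> (V * W)%type) : open O ->
  smooth_on O f -> smooth_on O (fun x => (f x).1).
Proof.
apply: smooth_linear_apply => [k x y|x]; [by []|exact: cvg_fst].
Qed.
Lemma smooth_snd U V W (O : set U) (f : U -> (V * W)%type) : open O ->
  smooth_on O f -> smooth_on O (fun x => (f x).2).
Proof.
apply: smooth_linear_apply => [k x y|x]; [by []|exact: cvg_snd].
Qed.
Lemma smooth_coord U m n (O : set U) (f : U -> 'M[R]_(m, n)) i j : open O ->
  smooth_on O f -> smooth_on O (fun x => f x i j).
Proof.
apply: (@smooth_linear_apply _ 'M[R]_(m, n) R _ (fun M => M i j)) => [k x y|x].
  by rewrite !mxE.
exact: coord_continuous.
Qed.

Lemma smooth_eq U V (O : set U) (f g : U -> V) : open O ->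
  (forall z, O z -> f z = g z) -> smooth_on O f -> smooth_on O g.
Proof.
move=> Oo fg fs.
apply: (@smooth_coind U V O
  (fun h => exists2 f, smooth_on O f & forall z, O z -> f z = h z)) => //.
- move=> h z [k ks kh] Oz; rewrite /prop_for /continuous_at -(kh z Oz).
  apply: cvg_trans (smooth_continuous ks Oz); apply: near_eq_cvg.
  by apply: filterS (open_nbhs_nbhs (conj Oo Oz)) => y /kh.
- move=> h d [k ks kh]; exists ('D_d k).
    by exists ('D_d k) => //; exact: smooth_derive.
  by move=> z Oz; apply: (near_is_derive Oo kh Oz); exact: smooth_is_derive ks Oz.
- by exists f.
Qed.

Lemma smooth_id U : smooth_on setT (@id U).
Proof.
apply: (@smooth_coind U U setT (fun h => (exists k, h = cst k) \/ h = id)).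
- exact: openT.
- by move=> _ z [[k ->]|->] _; [exact: cvg_cst | exact: cvg_id].
- move=> _ d [[k ->]|->].
    by exists (cst 0); [left; exists 0 | move=> z _; exact: is_derive_cst].
  by exists (cst d); [left; exists d | move=> z _; exact: is_derive_id].
- by right.
Qed.

End Smooth.

(** * Derivative of the determinant; multi-indices *)

Section Jacobi.
Variable R : realType.

Lemma is_derive_prod (I : eqType) (r : seq I) (f : I -> R -> R) (df : I -> R)
    (a v : R) :
  uniq r -> (forall i, is_derive a v (f i) (df i)) ->
  is_derive a v (fun t => \prod_(i <- r) f i t)
    (\sum_(i <- r) \prod_(j <- r) (if j == i then df j else f j a)).
Proof.
move=> + Hf; elim: r => [_|k r IH /= /andP[kr ur]].
  under eq_fun do rewrite big_nil.
  rewrite big_nil; exact: is_derive_cst.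
under eq_fun do rewrite big_cons.
rewrite big_cons big_cons eqxx.
have := is_derive_mul (Hf k) (IH ur); congr is_derive.
rewrite addrC; congr (_ + _).
  congr (_ * _); apply: eq_big_seq => j jr.
  by case: eqP => // jk; move: kr; rewrite -jk jr.
rewrite big_distrr /=; apply: eq_big_seq => i ir; rewrite big_cons.
by case: eqP => // ki; move: kr; rewrite ki ir.
Qed.

(** Jacobi's formula. Differentiating the Leibniz expansion replaces one row of [M a] by that row of
    [D]; Laplace expansion along it leaves the cofactors of [M a]. *)
Lemma is_derive_det n (M : R -> 'M[R]_n) (D : 'M[R]_n) (a v : R) :
  (forall i j, is_derive a v (fun t => M t i j) (D i j)) ->
  is_derive a v (fun t => \det (M t))
    (\sum_i \sum_j D i j * cofactor (M a) i j).
Proof.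
move=> HM.
have H1 : is_derive a v (fun t => \det (M t))
   (\sum_(s : 'S_n) (-1) ^+ s *
      \sum_i \prod_j (if j == i then D j (s j) else M a j (s j))).
  apply: is_derive_bigsum => s _.
  apply: is_deriveZ; apply: is_derive_prod.
  exact: index_enum_uniq.
suff E : \sum_(s : 'S_n) (-1) ^+ s *
      \sum_i \prod_j (if j == i then D j (s j) else M a j (s j)) =
    \sum_i \sum_j D i j * cofactor (M a) i j by rewrite -E.
under eq_bigr do rewrite big_distrr.
rewrite exchange_big /=; apply: eq_bigr => i _.
pose Mi := \matrix_(k, l) (if k == i then D k l else M a k l).
transitivity (\det Mi).
  apply: eq_bigr => s _; congr (_ * _); apply: eq_bigr => j _.
  by rewrite mxE.
rewrite (expand_det_row _ i); apply: eq_bigr => j _; rewrite mxE eqxx.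
congr (_ * _); rewrite /cofactor; congr (_ * \det _).
apply/matrixP => k l; rewrite !mxE.
by rewrite eq_sym (negbTE (neq_lift i k)).
Qed.

Lemma cofactor_mulr n (H : 'M[R]_n) i j : \det H = 1 ->
  \sum_k H i k * cofactor H j k = (i == j)%:R.
Proof.
move=> H1; have := congr1 (fun A : 'M[R]_n => A i j) (mul_mx_adj H).
rewrite !mxE H1 => <-; apply: eq_bigr => k _.
by rewrite mxE.
Qed.

End Jacobi.

Section MultiIndices.
Variable N : nat.
Implicit Types (i j a b : 'I_N) (J K : mindex N).

Lemma mincrC i j J : mincr i (mincr j J) = mincr j (mincr i J).
Proof. by apply/ffunP => k; rewrite !ffunE addnAC. Qed.

Lemma mdeg0 : mdeg (mindex0 N) = 0%N.
Proof. by rewrite /mdeg big1 // => i _; rewrite ffunE. Qed.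

Lemma mdeg_incr i J : mdeg (mincr i J) = (mdeg J).+1.
Proof.
rewrite /mdeg; under eq_bigr do rewrite ffunE.
rewrite big_split /= -addn1; congr (_ + _)%N.
by rewrite (bigD1 i) //= eqxx big1 // => j /negbTE ->.
Qed.

Lemma mem_mindices k J : (J \in mindices N k) = (mdeg J <= k)%N.
Proof.
rewrite mem_filter; case: leqP => //= Jk; apply/mapP.
have Jik i : (J i < k.+1)%N.
  by rewrite ltnS (leq_trans _ Jk) // /mdeg (bigD1 i) //= leq_addr.
exists [ffun i => Ordinal (Jik i)]; first by rewrite mem_enum.
by apply/ffunP => i; rewrite !ffunE.
Qed.

Lemma mindices_uniq k : uniq (mindices N k).
Proof.
apply: filter_uniq; rewrite map_inj_uniq ?enum_uniq // => f g /ffunP fg.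
by apply/ffunP => i; apply: val_inj; have := fg i; rewrite !ffunE.
Qed.

Lemma big_mindices (V : nmodType) k (F : mindex N -> V) K (P : pred (mindex N)) :
  (mdeg K <= k)%N -> P K -> (forall J, J != K -> F J = 0) ->
  \sum_(J <- mindices N k | P J) F J = F K.
Proof.
move=> Kk PK F0; rewrite -big_filter.
rewrite (bigD1_seq K) /=; first last.
- exact/filter_uniq/mindices_uniq.
- by rewrite mem_filter PK mem_mindices.
by rewrite big1 ?addr0 // => J; exact: F0.
Qed.

End MultiIndices.

(** * Total derivatives on the jet space *)

Definition ex (R : realType) N (i : 'I_N) : xuspace R N := (delta_mx i 0, 0).
Definition eu (R : realType) N : xuspace R N := (0, 1).

(* Locked, lest unification and [ring] compare directional derivatives by
   unfolding them. *)
HB.lock Definition dx (R : realType) N (i : 'I_N) (f : xuspace R N -> R) :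
  xuspace R N -> R := 'D_(ex R i) f.
HB.lock Definition du (R : realType) N (f : xuspace R N -> R) :
  xuspace R N -> R := 'D_(eu R N) f.

Lemma xu_decomp (R : realType) N (p : xuspace R N) :
  p = \sum_i p.1 i 0 *: ex R i + p.2 *: eu R N.
Proof.
case: p => x u /=; rewrite [x in LHS](matrix_sum_delta x).
have -> : \sum_i x i 0 *: ex R i = (\sum_i x i 0 *: delta_mx i 0, 0).
  elim/big_rec2: _ => // i y1 y2 _ ->.
  by rewrite /ex; congr pair => /=; rewrite scaler0 addr0.
congr pair => /=; last by rewrite add0r [_ *: 1]mulr1.
by rewrite scaler0 addr0; apply: eq_bigr => i _; rewrite big_ord1.
Qed.

Section TotalDerivative.
Variables (R : realType) (N : nat).
Implicit Types (P Q : jet R N -> R) (z : jet R N) (i a b : 'I_N) (J K : mindex N)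
  (f : xuspace R N -> R) (M : set (xuspace R N)).

Definition xline z i (t : R) : jet R N := (z.1 + t *: delta_mx i 0, z.2).
Definition uline z J (t : R) : jet R N :=
  (z.1, fun K => z.2 K + (if K == J then t else 0)).

Lemma jbase_xline z i t : jbase (xline z i t) = jbase z + t *: ex R i.
Proof. by congr pair => /=; rewrite scaler0 addr0. Qed.

Lemma jbase_uline z J t :
  jbase (uline z J t) = jbase z + t *: ((mindex0 N == J)%:R *: eu R N).
Proof.
rewrite /jbase /=; congr pair => /=; first by rewrite !scaler0 addr0.
by case: eqP => _; rewrite ?scale1r ?scale0r ?[t *: 1]mulr1 //= [t *: 0]mulr0.
Qed.

Lemma xline0 z i : xline z i 0 = z.
Proof. by case: z => x u; rewrite /xline /= scale0r addr0. Qed.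

Lemma uline0 z J : uline z J 0 = z.
Proof.
case: z => x u; rewrite /uline /=; congr pair; apply/funext => K.
by case: eqP; rewrite addr0.
Qed.

(* [total_D] is computed with the junk value of [derive1] when a partial
   derivative does not exist; this relation also records their existence. *)
Definition is_total_D k i P z (l : R) : Prop :=
  exists (gx : R) (gu : mindex N -> R),
  [/\ is_derive (0 : R) 1 (fun t => P (xline z i t)) gx,
      forall J, is_derive (0 : R) 1 (fun t => P (uline z J t)) (gu J) &
      l = gx + \sum_(J <- mindices N k) z.2 (mincr i J) * gu J].

Lemma total_DE k i P z l : is_total_D k i P z l -> total_D k i P z = l.
Proof.
move=> [gx [gu [Hx Hu ->]]]; rewrite /total_D /partial_x /partial_u.
congr (_ + _); first by rewrite derive1E; exact: (@derive_val _ _ _ _ _ _ _ Hx).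
apply: eq_bigr => J _; congr (_ * _).
by rewrite derive1E; exact: (@derive_val _ _ _ _ _ _ _ (Hu J)).
Qed.

Lemma is_total_DB k i P Q z l m :
  is_total_D k i P z l -> is_total_D k i Q z m ->
  is_total_D k i (fun y => P y - Q y) z (l - m).
Proof.
move=> [gx [gu [Hx Hu ->]]] [hx [hu [Kx Ku ->]]].
exists (gx - hx), (fun J => gu J - hu J); split.
- exact: is_derive_sub.
- by move=> J; apply: is_derive_sub.
- under [in RHS]eq_bigr do rewrite mulrBr.
  by rewrite big_split /= sumrN; ring.
Qed.

Lemma is_total_DD k i P Q z l m :
  is_total_D k i P z l -> is_total_D k i Q z m ->
  is_total_D k i (fun y => P y + Q y) z (l + m).
Proof.
move=> [gx [gu [Hx Hu ->]]] [hx [hu [Kx Ku ->]]].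
exists (gx + hx), (fun J => gu J + hu J); split.
- exact: is_derive_add.
- by move=> J; apply: is_derive_add.
- under [in RHS]eq_bigr do rewrite mulrDr.
  by rewrite big_split /=; ring.
Qed.

Lemma is_total_DM k i P Q z l m :
  is_total_D k i P z l -> is_total_D k i Q z m ->
  is_total_D k i (fun y => P y * Q y) z (P z * m + l * Q z).
Proof.
move=> [gx [gu [Hx Hu ->]]] [hx [hu [Kx Ku ->]]].
exists (P z * hx + gx * Q z), (fun J => P z * hu J + gu J * Q z); split.
- by have := is_derive_mul Hx Kx; rewrite xline0.
- by move=> J; have := is_derive_mul (Hu J) (Ku J); rewrite uline0.
- rewrite mulrDr mulrDl big_distrr big_distrl /= addrACA -big_split /=.
  by congr (_ + _); apply: eq_bigr => J _; ring.
Qed.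

Lemma is_total_D_cst k i (c : R) z : is_total_D k i (fun=> c) z 0.
Proof.
exists 0, (fun=> 0); split; [exact: is_derive_cst|move=> J; exact: is_derive_cst|].
by rewrite big1 ?addr0 // => J _; rewrite mulr0.
Qed.

Lemma is_total_D_sum k i (I : Type) (r : seq I) (P : I -> jet R N -> R) z
    (l : I -> R) :
  (forall j, is_total_D k i (P j) z (l j)) ->
  is_total_D k i (fun y => \sum_(j <- r) P j y) z (\sum_(j <- r) l j).
Proof.
move=> HP; elim: r => [|j r IH].
  by under eq_fun do rewrite big_nil; rewrite big_nil; exact: is_total_D_cst.
by under eq_fun do rewrite big_cons; rewrite big_cons; exact: is_total_DD.
Qed.

(** The bound on [mdeg K] ensures that the term [J = K] survives the truncation of the sum. *)
Lemma is_total_D_coord k i K z : (mdeg K <= k)%N ->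
  is_total_D k i (fun y => y.2 K) z (z.2 (mincr i K)).
Proof.
move=> Kk; exists 0, (fun J => (K == J)%:R); split.
- exact: is_derive_cst.
- move=> J; case: (altP (K =P J)) => KJ /=; last first.
    under eq_fun do rewrite (negbTE KJ).
    exact: is_derive_cst.
  under eq_fun do rewrite KJ eqxx.
  have := is_derive_add (is_derive_cst (z.2 J) (0 : R) (1 : R))
    (is_derive_id (0 : R) (1 : R)).
  by rewrite add0r.
- rewrite add0r (big_mindices Kk) ?eqxx ?mulr1 // => J /negbTE.
  by rewrite eq_sym => ->; rewrite mulr0.
Qed.

Lemma smooth_dx M i f : smooth_on M f -> smooth_on M (dx i f).
Proof. by rewrite dx.unlock; exact: smooth_derive. Qed.

Lemma smooth_du M f : smooth_on M f -> smooth_on M (du f).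
Proof. by rewrite du.unlock; exact: smooth_derive. Qed.

Lemma dx_cst i (k : R) : dx i (fun=> k) = fun _ : xuspace R N => 0.
Proof. by apply/funext => p; rewrite dx.unlock derive_cst. Qed.

Lemma du_cst (k : R) : du (fun=> k) = fun _ : xuspace R N => 0.
Proof. by apply/funext => p; rewrite du.unlock derive_cst. Qed.

Lemma is_total_D_base k i f M z : smooth_on M f -> M (jbase z) ->
  is_total_D k i (fun y => f (jbase y)) z
    (dx i f (jbase z) + z.2 (mincr i (mindex0 N)) * du f (jbase z)).
Proof.
move=> fs Mz; rewrite dx.unlock du.unlock.
exists ('D_(ex R i) f (jbase z)),
  (fun J => (mindex0 N == J)%:R * 'D_(eu R N) f (jbase z)); split.
- under eq_fun do rewrite jbase_xline.
  apply: is_derive_line; rewrite scale0r addr0.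
  exact: smooth_is_derive fs Mz.
- move=> J; under eq_fun do rewrite jbase_uline.
  apply: is_derive_line; rewrite scale0r addr0.
  by apply: is_derive_scale; exact: smooth_is_derive fs Mz.
- rewrite (@big_mindices _ _ _ _ (mindex0 N)) ?mdeg0 //.
    by rewrite eqxx mul1r.
  by move=> J; rewrite eq_sym => /negbTE ->; rewrite mul0r mulr0.
Qed.

Lemma open_line M p (d : xuspace R N) : open M ->
  open [set t : R | M (p + t *: d)].
Proof.
move=> Mo; apply: (@open_comp _ _ (fun t : R => p + t *: d) M) => // t _.
apply: cvgD; first exact: cvg_cst.
exact: scalel_continuous.
Qed.

(** Needed to iterate total derivatives: the first one has a closed form only over [M], and openness
    keeps short coordinate lines over [M]. *)
Lemma is_total_D_local k i P Q M z l : open M ->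
  (forall y, M (jbase y) -> P y = Q y) -> M (jbase z) ->
  is_total_D k i P z l -> is_total_D k i Q z l.
Proof.
move=> Mo PQ Mz [gx [gu [Hx Hu lE]]]; exists gx, gu; split => //.
- refine (@near_is_derive _ _ _ _ (fun t => P (xline z i t)) _ _ _ _
    (@open_line M (jbase z) (ex R i) Mo) _ _ Hx).
    by move=> t /=; rewrite -jbase_xline; exact: PQ.
  by rewrite /= scale0r addr0.
- move=> J.
  refine (@near_is_derive _ _ _ _ (fun t => P (uline z J t)) _ _ _ _
    (@open_line M (jbase z) ((mindex0 N == J)%:R *: eu R N) Mo) _ _ (Hu J)).
    by move=> t /=; rewrite -jbase_uline; exact: PQ.
  by rewrite /= scale0r addr0.
Qed.

End TotalDerivative.

(** * The prolongation formula *)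

Section IteratedOperators.
Variables (I : eqType) (X : Type) (D : I -> X -> X).
Let fold (n : I -> nat) (P : X) s := foldr (fun i Q => iter (n i) (D i) Q) P s.

Lemma foldr_iter0 n P s : {in s, forall i, n i = 0%N} -> fold n P s = P.
Proof.
elim: s => //= i s IH n0; rewrite n0 ?mem_head //=; apply: IH => j js.
by apply: n0; rewrite inE js orbT.
Qed.

Lemma foldr_iter1 (n : I -> nat) c P s : uniq s -> c \in s ->
  {in s, forall i, n i = (i == c) :> nat} -> fold n P s = D c P.
Proof.
elim: s => //= i s IH /andP[si us] + n0; rewrite n0 ?mem_head //.
have ns : {in s, forall i, n i = (i == c) :> nat}.
  by move=> j js; apply: n0; rewrite inE js orbT.
rewrite inE eq_sym; have [ic _|ci /= cs] := eqVneq i c; last exact: IH.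
rewrite ic /=; congr (D c _); apply: foldr_iter0 => j js; rewrite ns //.
by rewrite -ic; case: eqP => // ji; rewrite -ji js in si.
Qed.

(** [total_DJ] applies its operators in enumeration order, which does not tell whether [a] or [b]
    comes first; symmetry of mixed derivatives reconciles the two cases later. *)
Lemma foldr_iter2 (n : I -> nat) a b P s : uniq s -> a \in s -> b \in s ->
  {in s, forall i, n i = ((i == a) + (i == b))%N} ->
  fold n P s = D a (D b P) \/ fold n P s = D b (D a P).
Proof.
elim: s => //= i s IH /andP[si us] + + n0; rewrite n0 ?mem_head //.
have ns : {in s, forall i, n i = ((i == a) + (i == b))%N}.
  by move=> j js; apply: n0; rewrite inE js orbT.
have ni j : j \in s -> (j == i) = false.
  by move=> js; case: eqP => // ji; rewrite -ji js in si.
rewrite !inE ![_ == i]eq_sym.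
have [ia|ia] := eqVneq i a; have [ib|ib] := eqVneq i b => //= as_ bs.
- left; rewrite -ia -ib; congr (D _ (D _ _)); apply: foldr_iter0 => j js.
  by rewrite ns // -ia -ib ni.
- left; rewrite -ia; congr (D _ _); apply: foldr_iter1 => // j js.
  by rewrite ns // -ia ni.
- right; rewrite -ib; congr (D _ _); apply: foldr_iter1 => // j js.
  by rewrite ns // -ib ni // addn0.
- exact: IH.
Qed.

End IteratedOperators.

Section Prolongation.
Variables (R : realType) (N : nat).
Variables (M : set (xuspace R N)) (v : xuspace R N -> xuspace R N).
Implicit Types (z : jet R N) (i a b : 'I_N) (f : xuspace R N -> R).

Let phi : xuspace R N -> R := fun p => (v p).2.
Let xi i : xuspace R N -> R := fun p => (v p).1 i 0.

Hypothesis Mo : open M.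
Hypothesis phis : smooth_on M phi.
Hypothesis xis : forall i, smooth_on M (xi i).

Definition u1 z i : R := z.2 (mincr i (mindex0 N)).
Definition u2 z i j : R := z.2 (mincr i (mincr j (mindex0 N))).

Lemma u2C z i j : u2 z i j = u2 z j i.
Proof. by rewrite /u2 mincrC. Qed.

(* The part of [D_a (D_b f)] that does not involve second derivatives of u. *)
Definition totalD2_xu f a b z : R :=
  dx a (dx b f) (jbase z) + u1 z a * du (dx b f) (jbase z)
  + u1 z b * (dx a (du f) (jbase z)
              + u1 z a * du (du f) (jbase z)).

Definition totalD1_xu f a z : R :=
  dx a f (jbase z) + u1 z a * du f (jbase z).

Lemma is_total_D_base2 f a z : smooth_on M f -> M (jbase z) ->
  is_total_D 2 a (fun y => f (jbase y)) z (totalD1_xu f a z).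
Proof. exact: is_total_D_base. Qed.

Lemma is_total_D_totalD1_xu f a b z : smooth_on M f -> M (jbase z) ->
  is_total_D 2 a (totalD1_xu f b) z
    (totalD2_xu f a b z + u2 z a b * du f (jbase z)).
Proof.
move=> fs Mz; rewrite /totalD2_xu -!addrA addrA.
apply: is_total_DD.
  by apply: (is_total_D_base2 _ _ Mz); exact: smooth_dx.
apply: is_total_DM.
  by apply: is_total_D_coord; rewrite mdeg_incr mdeg0.
by apply: (is_total_D_base2 _ _ Mz); exact: smooth_du.
Qed.

Lemma DD_comm f d e p : smooth_on M f -> M p ->
  'D_d ('D_e f) p = 'D_e ('D_d f) p.
Proof.
move=> fs Mp; symmetry.
apply: (@Schwarz _ _ M f ('D_d f) ('D_e f) ('D_e ('D_d f)) ('D_d ('D_e f)) p d e) => //.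
- by move=> y My; exact: smooth_is_derive fs My.
- by move=> y My; exact: smooth_is_derive fs My.
- by move=> y My; apply: (smooth_is_derive _ _ My); exact: smooth_derive.
- by move=> y My; apply: (smooth_is_derive _ _ My); exact: smooth_derive.
- by apply: (smooth_continuous _ Mp); do 2 apply: smooth_derive.
- by apply: (smooth_continuous _ Mp); do 2 apply: smooth_derive.
Qed.

Lemma dxC f a b p : smooth_on M f -> M p -> dx a (dx b f) p = dx b (dx a f) p.
Proof. by rewrite dx.unlock; exact: DD_comm. Qed.

Lemma dx_du f a p : smooth_on M f -> M p -> dx a (du f) p = du (dx a f) p.
Proof. by rewrite dx.unlock du.unlock; exact: DD_comm. Qed.

Lemma totalD2_xuC f a b z : smooth_on M f -> M (jbase z) ->
  totalD2_xu f a b z = totalD2_xu f b a z.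
Proof.
move=> fs Mz; rewrite /totalD2_xu (dxC a b fs Mz) !(dx_du _ fs Mz); ring.
Qed.

(** The characteristic of [v], spelled as in [prolong_coef] so that the two match by conversion. *)
Let char : jet R N -> R := fun y =>
  phi_of v y - \sum_i xi_of v i y * y.2 (mincr i (mindex0 N)).

Let char1 b : jet R N -> R := fun y =>
  totalD1_xu phi b y
  - \sum_i (xi i (jbase y) * y.2 (mincr b (mincr i (mindex0 N)))
            + totalD1_xu (xi i) b y * y.2 (mincr i (mindex0 N))).

Lemma totalD_char b z : M (jbase z) -> total_D 2 b char z = char1 b z.
Proof.
move=> Mz; apply: total_DE; apply: is_total_DB.
  exact: (is_total_D_base2 _ phis Mz).
apply: is_total_D_sum => i; apply: is_total_DM.
  exact: (is_total_D_base2 _ (xis i) Mz).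
by apply: is_total_D_coord; rewrite mdeg_incr mdeg0.
Qed.

Lemma totalD2_char a b z : M (jbase z) ->
  total_D 2 a (total_D 2 b char) z =
  totalD2_xu phi a b z + u2 z a b * du phi (jbase z)
  - \sum_i (xi i (jbase z) * z.2 (mincr a (mincr b (mincr i (mindex0 N))))
       + totalD1_xu (xi i) a z * u2 z b i
       + (totalD1_xu (xi i) b z * u2 z a i
       + (totalD2_xu (xi i) a b z + u2 z a b * du (xi i) (jbase z)) * u1 z i)).
Proof.
move=> Mz; apply: total_DE.
apply: (is_total_D_local (P := char1 b) Mo) => //.
  by move=> y My; rewrite totalD_char.
apply: is_total_DB; first exact: (is_total_D_totalD1_xu _ _ phis Mz).
apply: is_total_D_sum => i; apply: is_total_DD; apply: is_total_DM.
- exact: (is_total_D_base2 _ (xis i) Mz).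
- by apply: is_total_D_coord; rewrite !mdeg_incr mdeg0.
- exact: (is_total_D_totalD1_xu _ _ (xis i) Mz).
- by apply: is_total_D_coord; rewrite mdeg_incr mdeg0.
Qed.

(** The third-order coordinates produced by differentiating the characteristic twice cancel against
    the correction xi^i D_i u_J. *)
Lemma prolong_coef2 a b z : M (jbase z) ->
  prolong_coef 2 v (mincr a (mincr b (mindex0 N))) z =
  totalD2_xu phi a b z + u2 z a b * du phi (jbase z)
  - \sum_i (totalD1_xu (xi i) a z * u2 z b i + totalD1_xu (xi i) b z * u2 z a i
       + (totalD2_xu (xi i) a b z + u2 z a b * du (xi i) (jbase z)) * u1 z i).
Proof.
move=> Mz; rewrite /prolong_coef.
have -> : \sum_i xi_of v i z *
    total_D 2 i (fun y => y.2 (mincr a (mincr b (mindex0 N)))) z =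
    \sum_i xi i (jbase z) * z.2 (mincr a (mincr b (mincr i (mindex0 N)))).
  apply: eq_bigr => i _; congr (_ * _).
  rewrite (total_DE (is_total_D_coord _ _ _)) ?mdeg_incr ?mdeg0 //.
  by rewrite mincrC; congr (z.2 (mincr a _)); rewrite mincrC.
have [E|E] : total_DJ 2 (mincr a (mincr b (mindex0 N))) char =
       total_D 2 a (total_D 2 b char) \/
     total_DJ 2 (mincr a (mincr b (mindex0 N))) char =
       total_D 2 b (total_D 2 a char).
- apply: foldr_iter2; rewrite ?mem_enum ?enum_uniq //.
  by move=> i _; rewrite !ffunE add0n addnC.
- rewrite [X in X + _](congr1 (@^~ z) E) totalD2_char //.
  rewrite -addrA; congr (_ + _); rewrite addrC -sumrB -sumrN; apply: eq_bigr => i _.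
  ring.
- rewrite [X in X + _](congr1 (@^~ z) E) totalD2_char //.
  rewrite totalD2_xuC // [u2 z b a]u2C.
  rewrite -addrA; congr (_ + _); rewrite addrC -sumrB -sumrN; apply: eq_bigr => i _.
  rewrite (totalD2_xuC b a (xis i) Mz) [mincr b (mincr a _)]mincrC; ring.
Qed.

Lemma jet_hessian_sym z : (jet_hessian z)^T = jet_hessian z.
Proof. by apply/matrixP => i j; rewrite !mxE mincrC. Qed.

(** For a != b the single coordinate u_J with J = e_a + e_b fills two entries of the Hessian, hence
    the sum over ordered pairs. *)
Lemma partial_u_monge_ampere J z :
  partial_u J (monge_ampere R N) z =
  \sum_a \sum_b (mincr a (mincr b (mindex0 N)) == J)%:R * cofactor (jet_hessian z) a b.
Proof.
rewrite /partial_u derive1E.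
have H : is_derive (0 : R) 1 (fun t => monge_ampere R N (uline z J t))
   (\sum_a \sum_b (mincr a (mincr b (mindex0 N)) == J)%:R *
      cofactor (jet_hessian (uline z J 0)) a b - 0).
  apply: (@is_derive_sub _ _ _ (fun t => \det (jet_hessian (uline z J t))) (fun=> 1)).
  have := @is_derive_det R N (fun t => jet_hessian (uline z J t))
    (\matrix_(a, b) (mincr a (mincr b (mindex0 N)) == J)%:R) 0 1.
  under eq_bigr do under eq_bigr do rewrite mxE.
  apply=> a b; rewrite mxE; under eq_fun do rewrite mxE /=.
  case: eqP => _ /=.
    have := is_derive_add
      (is_derive_cst (z.2 (mincr a (mincr b (mindex0 N)))) (0 : R) (1 : R))
      (is_derive_id (0 : R) (1 : R)).
    by rewrite add0r.
  by exact: is_derive_cst.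
rewrite subr0 uline0 in H.
exact: (@derive_val _ _ _ _ _ _ _ H).
Qed.

Lemma prolong_monge_ampere z : M (jbase z) -> \det (jet_hessian z) = 1 ->
  prolong 2 v (monge_ampere R N) z =
  \sum_a \sum_b cofactor (jet_hessian z) a b *
     (totalD2_xu phi a b z - \sum_i totalD2_xu (xi i) a b z * u1 z i)
  + N%:R * (du phi (jbase z) - \sum_i du (xi i) (jbase z) * u1 z i)
  - 2 * \sum_i totalD1_xu (xi i) i z.
Proof.
move=> Mz det1; pose C := cofactor (jet_hessian z).
have Csym a b : C a b = C b a.
  by rewrite /C -cofactor_tr jet_hessian_sym.
have Cu2 i j : \sum_k u2 z i k * C j k = (i == j)%:R.
  have := cofactor_mulr i j det1; under eq_bigr do rewrite mxE; exact.
have -> : prolong 2 v (monge_ampere R N) z =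
  \sum_a \sum_b C a b * prolong_coef 2 v (mincr a (mincr b (mindex0 N))) z.
  rewrite /prolong big1 => [|i _]; last first.
    (* The equation does not involve [x], so along an [x]-line it is a constant function by
       conversion. *)
    rewrite /partial_x derive1E -[X in _ * X]/('D_1 (cst (monge_ampere R N z)) (0:R)).
    by rewrite derive_cst mulr0.
  rewrite add0r partial_u_monge_ampere big1 => [|a _]; last first.
    (* Nor does it involve [u] itself: a multi-index of degree 2 is never [mindex0]. *)
    apply: big1 => b _; case: eqP => [/(congr1 (@mdeg N))|_]; last by rewrite mul0r.
    by rewrite !mdeg_incr mdeg0.
  rewrite mulr0 add0r.
  under eq_bigr do rewrite partial_u_monge_ampere big_distrr.
  rewrite exchange_big /=; apply: eq_bigr => a _.
  under eq_bigr do rewrite big_distrr.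
  rewrite exchange_big /=; apply: eq_bigr => b _.
  rewrite (@big_mindices _ _ _ _ (mincr a (mincr b (mindex0 N)))) ?mdeg_incr ?mdeg0 //.
    by rewrite eqxx mul1r mulrC.
  by move=> J; rewrite eq_sym => /negbTE ->; rewrite mul0r mulr0.
pose S a b := totalD2_xu phi a b z - \sum_i totalD2_xu (xi i) a b z * u1 z i.
pose c := du phi (jbase z) - \sum_i du (xi i) (jbase z) * u1 z i.
have E a b : C a b * prolong_coef 2 v (mincr a (mincr b (mindex0 N))) z =
   C a b * S a b + c * (u2 z a b * C a b)
   - (C a b * \sum_i totalD1_xu (xi i) a z * u2 z b i
      + C a b * \sum_i totalD1_xu (xi i) b z * u2 z a i).
  have -> : prolong_coef 2 v (mincr a (mincr b (mindex0 N))) z = S a b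
      + c * u2 z a b - (\sum_i totalD1_xu (xi i) a z * u2 z b i
      + \sum_i totalD1_xu (xi i) b z * u2 z a i); last by ring.
  rewrite prolong_coef2 // big_split big_split /=.
  under [X in _ - (_ + X)]eq_bigr do rewrite mulrDl -mulrA.
  by rewrite big_split -big_distrr /= /S /c; ring.
have F a b i : totalD1_xu (xi i) a z * u2 z b i * C a b =
   totalD1_xu (xi i) a z * (u2 z i b * C a b) by rewrite [u2 z b i]u2C mulrA.
have [c' cE] : exists c', c' = c by exists c.
have [D DE] : exists D, D = \sum_i totalD1_xu (xi i) i z by eexists.
rewrite -/c -cE -DE; under eq_bigr do under eq_bigr do rewrite E -cE.
under eq_bigr do rewrite sumrB !big_split -big_distrr /= Cu2 eqxx mulr1.
rewrite sumrB !big_split /=.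
rewrite sumr_const card_ord -[c' *+ N]mulr_natl.
(* Contracting the Hessian with its inverse leaves only the terms [i = a], that is, the total
   divergence of xi; the same happens in [H2] with [a] and [b] exchanged. *)
have H1 : \sum_a \sum_b C a b * \sum_i totalD1_xu (xi i) a z * u2 z b i =
    D.
  rewrite DE; apply: eq_bigr => a _; under eq_bigr do rewrite big_distrr /=.
  rewrite exchange_big /= (bigD1 a) //= [X in _ + X]big1 ?addr0 => [|i ia].
    under eq_bigr do rewrite mulrC F.
    by rewrite -big_distrr /= Cu2 eqxx mulr1.
  under eq_bigr do rewrite mulrC F.
  by rewrite -big_distrr /= Cu2 (negbTE ia) mulr0.
have H2 : \sum_a \sum_b C a b * \sum_i totalD1_xu (xi i) b z * u2 z a i =
    D.
  by rewrite exchange_big -H1; do 2 apply: eq_bigr => ? _; rewrite Csym.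
by rewrite H1 H2; ring.
Qed.

End Prolongation.

(** * Separating the determining equations *)

(** Matrix determinant lemma. [X *m Y] and [Y *m X] are both block lower triangular, with nontrivial
    diagonal blocks 1 + c r and 1 + r c, and [Y] has determinant 1. *)
Lemma det_1D_mulmx (R : comNzRingType) n (c : 'cV[R]_n) (r : 'rV[R]_n) :
  \det (1%:M + c *m r) = 1 + (r *m c) 0 0.
Proof.
pose X : 'M[R]_(1 + n) := block_mx 1%:M (- r) c 1%:M.
pose Y : 'M[R]_(1 + n) := block_mx 1%:M r 0 1%:M.
have detY : \det Y = 1 by rewrite det_ublock !det1 mulr1.
have E1 : \det X = \det (1%:M + c *m r).
  transitivity (\det (X *m Y)); first by rewrite det_mulmx detY mulr1.
  rewrite mulmx_block.
  rewrite !mul1mx !mulmx1 !mulmx0 !addr0 subrr.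
  by rewrite det_lblock det1 mul1r addrC.
have E2 : \det X = 1 + (r *m c) 0 0.
  transitivity (\det (Y *m X)); first by rewrite det_mulmx detY mul1r.
  rewrite mulmx_block.
  rewrite !mul1mx !mulmx1 !mul0mx !add0r addNr.
  by rewrite det_lblock det1 mulr1 det_mx11 mxE [1%:M 0 0]mxE eqxx.
by rewrite -E1 E2.
Qed.

Section SymmetricForms.
Variable R : realType.

Lemma sum_delta2 n (S : 'I_n -> 'I_n -> R) a b :
  \sum_i \sum_j ((i == a)%:R * (j == b)%:R) * S i j = S a b.
Proof.
rewrite (bigD1 a) //= [X in _ + X]big1 ?addr0 => [|i /negbTE ia]; last first.
  by apply: big1 => j _; rewrite ia !mul0r.
rewrite (bigD1 b) //= [X in _ + X]big1 ?addr0 => [|j /negbTE jb].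
  by rewrite !eqxx !mul1r.
by rewrite jb mulr0 mul0r.
Qed.

(** The matrix 1 + s E_ab, written as a rank-one update so that [det_1D_mulmx] gives its
    determinant. *)
Definition shear n (a b : 'I_n) (s : R) : 'M[R]_n :=
  1%:M + (s *: delta_mx a 0 : 'cV_n) *m (delta_mx 0 b : 'rV_n).

Lemma shearE n (a b : 'I_n) s i j :
  shear a b s i j = (i == j)%:R + s * ((i == a)%:R * (j == b)%:R).
Proof.
rewrite !mxE big_ord1 !mxE /= !andbT; congr (_ + _).
by rewrite mulrA.
Qed.

Lemma det_shear n (a b : 'I_n) s : a != b -> \det (shear a b s) = 1.
Proof.
move=> ab; rewrite det_1D_mulmx -scalemxAr mul_delta_mx_cond eq_sym (negbTE ab).
by rewrite scaler0 mxE addr0.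
Qed.

Lemma shearN n (a b : 'I_n) s : a != b -> shear a b s *m shear a b (- s) = 1%:M.
Proof.
move=> ab; rewrite /shear mulmxDl !mulmxDr !mul1mx mulmx1.
rewrite -!scalemxAl -!scalemxAr !mulmxA -[_ *m delta_mx a 0]mulmxA.
rewrite [delta_mx 0 b *m _]mul_delta_mx_cond eq_sym (negbTE ab) mulmx0 mul0mx.
by rewrite !scaler0 addr0 scaleNr subrK.
Qed.

(* For a shear [P], [P P^T] is the cofactor matrix of its inverse [H], and these
   symmetric matrices of determinant 1 suffice to determine the form. *)
Lemma cofactor_forms_eq0 n (S : 'I_n -> 'I_n -> R) (k : R) : (1 < n)%N ->
  (forall H : 'M[R]_n, H^T = H -> \det H = 1 ->
     \sum_a \sum_b cofactor H a b * S a b + k = 0) ->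
  (forall a b, S a b = S b a) -> (forall a b, S a b = 0) /\ k = 0.
Proof.
move=> n1 HS Ssym.
(* This is the form evaluated at P P^T = 1 + s (E_ab + E_ba) + s^2 E_aa. *)
have Q a b s : a != b ->
    \sum_i S i i + s * (S a b + S b a) + s ^+ 2 * S a a + k = 0.
  move=> ab; pose P := shear a b s; pose Pi := shear a b (- s).
  have PPi : P *m Pi = 1%:M by exact: shearN.
  have PiP : Pi *m P = 1%:M by rewrite /P -[s]opprK; exact: shearN.
  pose H := Pi^T *m Pi.
  have Hsym : H^T = H by rewrite trmx_mul trmxK.
  have detH : \det H = 1 by rewrite det_mulmx det_tr det_shear ?mulr1.
  (* The adjugate of a matrix of determinant 1 is its inverse, and [H] was built as the inverse of P
     P^T. *)
  have CE : \adj H = P *m P^T.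
    have : \adj H *m H = 1%:M by rewrite mul_adj_mx detH.
    move/(congr1 (mulmx^~ (P *m P^T))); rewrite mul1mx => <-.
    rewrite /H -!mulmxA [Pi *m (_ *m _)]mulmxA PiP mul1mx -trmx_mul PPi.
    by rewrite trmx1 mulmx1.
  have CE' i j : cofactor H i j = (i == j)%:R +
     (s * ((i == a)%:R * (j == b)%:R) + s * ((i == b)%:R * (j == a)%:R))
      + s ^+ 2 * ((i == a)%:R * (j == a)%:R).
    have -> : cofactor H i j = (P *m P^T) j i by rewrite -CE mxE.
    rewrite mxE; under eq_bigr do rewrite [P^T _ _]mxE !shearE.
    under eq_bigr => l _.
      rewrite (_ : _ * _ = (l == j)%:R * (i == l)%:R +
        s * ((l == b)%:R * ((j == l)%:R * (i == a)%:R)) +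
        s * ((l == b)%:R * ((i == l)%:R * (j == a)%:R)) +
        s ^+ 2 * ((l == b)%:R * ((j == a)%:R * (i == a)%:R))); last first.
        have bb : (l == b)%:R * (l == b)%:R = (l == b)%:R :> R.
          by case: (l == b); rewrite ?mulr1 ?mulr0.
        rewrite [j == l]eq_sym.
        rewrite -[X in s ^+ 2 * (X * _)]bb; ring.
      over.
    have sb (c : 'I_n) (F : 'I_n -> R) : \sum_l (l == c)%:R * F l = F c.
      rewrite (bigD1 c) //= eqxx mul1r big1 ?addr0 // => l /negbTE ->.
      by rewrite mul0r.
    rewrite !big_split -!big_distrr /= !sb.
    by rewrite ![_ == b]eq_sym; ring.
  rewrite -[RHS](HS H Hsym detH); congr (_ + _).
  under [RHS]eq_bigr do under eq_bigr do rewrite CE' !mulrDl -!mulrA.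
  under [RHS]eq_bigr do rewrite !big_split -!big_distrr /=.
  rewrite !big_split -!big_distrr /=.
  have D (c d : 'I_n) : \sum_i (i == c)%:R * (\sum_j (j == d)%:R * S i j) = S c d.
    rewrite -(sum_delta2 S c d); apply: eq_bigr => i _; rewrite big_distrr /=.
    by apply: eq_bigr => j _; rewrite mulrA.
  have D' (c d : 'I_n) : \sum_i \sum_j (i == c)%:R * ((j == d)%:R * S i j) = S c d.
    rewrite -(sum_delta2 S c d); apply: eq_bigr => i _.
    by apply: eq_bigr => j _; rewrite mulrA.
  rewrite ?D ?D'.
  have -> : \sum_i \sum_j (i == j)%:R * S i j = \sum_i S i i.
    apply: eq_bigr => i _; rewrite (bigD1 i) //= eqxx mul1r big1 ?addr0 // => j.
    by rewrite eq_sym => /negbTE ->; rewrite mul0r.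
  by ring.
have Sab a b : a != b -> S a a = 0 /\ S a b = 0.
  (* The values 0, 1 and -1 of [s] separate the three coefficients of a quadratic polynomial. *)
  move=> ab; have := Q a b 1 ab; have := Q a b (-1) ab; have := Q a b 0 ab.
  rewrite -(Ssym a b); set t := \sum_i _ => h0 h1 h2.
  by split; lra.
have ex a : exists b : 'I_n, a != b.
  have n0 : (0 < n)%N by apply: ltnW.
  have [->|a0] := eqVneq a (Ordinal n0); first by exists (Ordinal n1).
  by exists (Ordinal n0).
have Saa a : S a a = 0 by have [b /Sab[]] := ex a.
split=> [a b|].
  by have [->|/Sab[]] := eqVneq a b.
have n0 : (0 < n)%N by apply: ltnW.
have [b ab] := ex (Ordinal n0).
have := Q _ _ 0 ab; rewrite big1 => [|i _]; last exact: Saa.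
by rewrite mul0r expr0n /= mul0r !addr0 add0r.
Qed.

End SymmetricForms.

(** * Jets with given base point, gradient and Hessian *)

Section PrescribedJet.
Variables (R : realType) (N : nat).

(* At J = e_a + e_b, J_i J_j - delta_ij J_i = delta_ia delta_jb + delta_ib delta_ja,
   whence the factor 1/2. *)
Definition jet_of (q : xuspace R N) (p : 'I_N -> R) (H : 'M[R]_N) : jet R N :=
  (q.1, fun J =>
     if mdeg J == 0%N then q.2
     else if mdeg J == 1%N then \sum_i (J i)%:R * p i
     else 2^-1 * \sum_i \sum_j
            ((J i)%:R * (J j)%:R - (i == j)%:R * (J i)%:R) * H i j).

Lemma jbase_jet_of q p H : jbase (jet_of q p H) = q.
Proof. by case: q => x u; rewrite /jbase /= mdeg0. Qed.

Lemma u1_jet_of q p H i : u1 (jet_of q p H) i = p i.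
Proof.
rewrite /u1 /= mdeg_incr mdeg0 /= (bigD1 i) //= !ffunE eqxx mul1r big1 ?addr0 //.
by move=> j /negbTE ji; rewrite !ffunE ji mul0r.
Qed.

Lemma jet_hessian_jet_of q p (H : 'M[R]_N) : H^T = H ->
  jet_hessian (jet_of q p H) = H.
Proof.
move=> Hs; apply/matrixP => a b; rewrite mxE /= !mdeg_incr mdeg0 /=.
have Hab : H b a = H a b by rewrite -{1}Hs mxE.
have E i j : (((mincr a (mincr b (mindex0 N))) i)%:R *
     ((mincr a (mincr b (mindex0 N))) j)%:R -
     (i == j)%:R * ((mincr a (mincr b (mindex0 N))) i)%:R) * H i j =
   ((i == a)%:R * (j == b)%:R) * H i j + ((i == b)%:R * (j == a)%:R) * H i j :> R.
  rewrite !ffunE !add0n !natrD.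
  have dd (c : 'I_N) : (i == j)%:R * (i == c)%:R = (i == c)%:R * (j == c)%:R :> R.
    rewrite -!natrM !mulnb; congr ((nat_of_bool _)%:R).
    have [->|] := eqVneq i j; first by case: eqP.
    by have [->|//] := eqVneq i c; rewrite eq_sym => /negbTE ->.
  by rewrite [(i == j)%:R * (_ + _)]mulrDr !dd; ring.
under eq_bigr do under eq_bigr do rewrite E.
under eq_bigr do rewrite big_split /=.
by rewrite big_split /= !sum_delta2 Hab; field.
Qed.

End PrescribedJet.

(** * Solving the determining equations *)

Section DeterminingEquations.
Variables (R : realType) (N : nat).
Variables (M : set (xuspace R N)) (v : xuspace R N -> xuspace R N).
Implicit Types (q : xuspace R N) (i a b : 'I_N) (f : xuspace R N -> R).

Let phi : xuspace R N -> R := fun p => (v p).2.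
Let xi i : xuspace R N -> R := fun p => (v p).1 i 0.

Hypothesis N1 : (1 < N)%N.
Hypothesis Mo : open M.
Hypothesis phis : smooth_on M phi.
Hypothesis xis : forall i, smooth_on M (xi i).
Hypothesis v_sym : symmetry_generator 2 (monge_ampere R N) M v.

Lemma dx_local f g a q : (forall y, M y -> f y = g y) -> M q ->
  dx a f q = dx a g q.
Proof.
move=> fg Mq; rewrite dx.unlock; apply: near_eq_derive.
by apply: filterS (open_nbhs_nbhs (conj Mo Mq)) => y; exact: fg.
Qed.

Lemma du_local f g q : (forall y, M y -> f y = g y) -> M q ->
  du f q = du g q.
Proof.
move=> fg Mq; rewrite du.unlock; apply: near_eq_derive.
by apply: filterS (open_nbhs_nbhs (conj Mo Mq)) => y; exact: fg.
Qed.

Let T f a b q (p : 'I_N -> R) : R :=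
  dx a (dx b f) q + p a * du (dx b f) q
  + p b * (dx a (du f) q + p a * du (du f) q).

(** Over a point of [M], [jet_of] realizes every gradient together with every symmetric Hessian of
    determinant 1. With [p] fixed, the criterion is thus an identity in the cofactors, which
    [cofactor_forms_eq0] splits. *)
Lemma determining_equations q p : M q ->
  (forall a b, T phi a b q p - \sum_i T (xi i) a b q p * p i = 0) /\
  N%:R * (du phi q - \sum_i du (xi i) q * p i)
  - 2 * \sum_i (dx i (xi i) q + p i * du (xi i) q) = 0.
Proof.
move=> Mq; apply: cofactor_forms_eq0 => // [H Hs detH|a b].
  have Mz : M (jbase (jet_of q p H)) by rewrite jbase_jet_of.
  have det1 : \det (jet_hessian (jet_of q p H)) = 1 by rewrite jet_hessian_jet_of.
  have := v_sym Mz; rewrite {1}/monge_ampere det1 subrr => /(_ erefl).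
  rewrite (prolong_monge_ampere Mo phis xis Mz det1) => E; rewrite -[RHS]E.
  rewrite jet_hessian_jet_of // -addrA /totalD2_xu /totalD1_xu jbase_jet_of.
  congr (_ + (_ - _)).
  - apply: eq_bigr => a _; apply: eq_bigr => b _; rewrite !u1_jet_of.
    congr (_ * (_ - _)); apply: eq_bigr => i _; by rewrite u1_jet_of.
  - congr (_ * (_ - _)); apply: eq_bigr => i _; by rewrite u1_jet_of.
  - by congr (_ * _); apply: eq_bigr => i _; rewrite u1_jet_of.
have TC f : smooth_on M f -> T f a b q p = T f b a q p.
  move=> fs; rewrite /T (dxC Mo a b fs Mq) !(dx_du Mo _ fs Mq); ring.
rewrite (TC _ phis); congr (_ - _); apply: eq_bigr => i _.
by rewrite (TC _ (xis i)).
Qed.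

(** The cofactor-free equation is affine in [p]; comparing [p = 0] with the i-th unit vector
    isolates the coefficient of p_i, which is -(N + 2) times the [u]-derivative of xi^i. *)
Lemma du_xi0 q i : M q -> du (xi i) q = 0.
Proof.
move=> Mq; have [_ E0] := determining_equations (fun=> 0) Mq.
have [_ E1] := determining_equations (fun j => (j == i)%:R) Mq.
have sd (F : 'I_N -> R) : \sum_j F j * (j == i)%:R = F i.
  rewrite (bigD1 i) //= eqxx mulr1 big1 ?addr0 // => j /negbTE ->.
  by rewrite mulr0.
move: E0 E1; rewrite sd big1 => [|j _]; last by rewrite mulr0.
rewrite subr0 !big_split /= [X in _ - 2 * (_ + X)]big1 => [|j _]; last by rewrite mul0r.
under [X in _ -> _ - 2 * (_ + X) = _ -> _]eq_bigr do rewrite mulrC.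
rewrite sd addr0.
set D := \sum_(_ | _) _; set x := du (xi i) q => E0 E1.
have : (N%:R + 2) * x = 0 by rewrite -[RHS](subrr (0 : R)) -{1}E0 -E1; ring.
move/eqP; rewrite mulf_eq0 => /orP[|/eqP //].
by rewrite gt_eqF // ltr_wpDl.
Qed.

Lemma divergence_xi q : M q -> N%:R * du phi q = 2 * \sum_i dx i (xi i) q.
Proof.
move=> Mq; have [_] := determining_equations (fun=> 0) Mq.
rewrite big1 => [|j _]; last by rewrite mulr0.
rewrite subr0 !big_split /= [X in _ - 2 * (_ + X)]big1 => [|j _]; last by rewrite mul0r.
by rewrite addr0 => /eqP; rewrite subr_eq0 => /eqP.
Qed.

(** Once xi is independent of [u], taking [p] equal to [s] times the k-th unit vector makes the
    equation quadratic in [s]; the three conclusions are its coefficients. *)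
Lemma second_order_equations q a b k : M q ->
  [/\ dx a (dx b phi) q = 0,
    dx a (dx b (xi k)) q =
      (a == k)%:R * du (dx b phi) q + (b == k)%:R * dx a (du phi) q &
    (a == k)%:R * (b == k)%:R * du (du phi) q = 0].
Proof.
move=> Mq.
have dd0 i : [/\ du (dx b (xi i)) q = 0, dx a (du (xi i)) q = 0 &
     du (du (xi i)) q = 0].
  have xu y : M y -> du (xi i) y = (fun=> 0 : R) y by move=> My; rewrite du_xi0.
  rewrite -(dx_du Mo b (xis i) Mq) !(dx_local _ xu Mq) !dx_cst.
  by rewrite (du_local xu Mq) du_cst.
have E p : T phi a b q p - \sum_i dx a (dx b (xi i)) q * p i = 0.
  have [/(_ a b) + _] := determining_equations p Mq.
  under eq_bigr => i _.
    rewrite /T; have [-> -> ->] := dd0 i.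
    rewrite !mulr0 !addr0 mulr0 addr0.
    over.
  by [].
have phi_ab : dx a (dx b phi) q = 0.
  move: (E (fun=> 0)); rewrite /T big1 => [|i _]; last by rewrite mulr0.
  by rewrite !mul0r !addr0 subr0.
have Es s : s * ((a == k)%:R * du (dx b phi) q + (b == k)%:R * dx a (du phi) q
      - dx a (dx b (xi k)) q)
    + s ^+ 2 * ((a == k)%:R * (b == k)%:R * du (du phi) q) = 0.
  rewrite -[RHS](E (fun j => s * (j == k)%:R)) (bigD1 k) //= eqxx big1.
    rewrite /T phi_ab; move: (dx a _ q) (dx a _ q) (du _ q) (du _ q) => w1 w2 w3 w4.
    by case: (a == k); case: (b == k); rewrite /=; ring.
  by move=> j /negbTE ->; rewrite !mulr0.
(* The constant coefficient is already gone, so [s = 1] and [s = -1] separate the linear part from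
   the quadratic one. *)
move: (Es 1) (Es (-1)); set X := _ * _ + _ - _; set Y := _ * _ * _ => h1 h2.
split => //; last by lra.
by apply/esym/eqP; rewrite -subr_eq0 -/X; apply/eqP; lra.
Qed.

Lemma is_derive_dx f a q : smooth_on M f -> M q -> is_derive q (ex R a) f (dx a f q).
Proof. by rewrite dx.unlock => fs Mq; exact: smooth_is_derive fs Mq. Qed.

Lemma is_derive_du f q : smooth_on M f -> M q -> is_derive q (eu R N) f (du f q).
Proof. by rewrite du.unlock => fs Mq; exact: smooth_is_derive fs Mq. Qed.

(** Differentiate the divergence relation in x^a. By the second-order equations its right-hand side
    becomes 2 (N + 1) phi_au, against N phi_au on the left, so (N + 2) phi_au = 0. *)
Lemma dx_du_phi0 q a : M q -> dx a (du phi) q = 0.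
Proof.
move=> Mq.
have E1 : dx a (fun y => N%:R * du phi y) q = N%:R * dx a (du phi) q.
  rewrite {1}dx.unlock; apply: (@derive_val _ _ _ _ _ _ _ _).
  apply: (is_deriveZ (N%:R : R)).
  exact: (is_derive_dx _ (smooth_du phis) Mq).
have E2 : dx a (fun y => 2 * \sum_i dx i (xi i) y) q =
    2 * \sum_i dx a (dx i (xi i)) q.
  rewrite {1}dx.unlock; apply: (@derive_val _ _ _ _ _ _ _ _).
  apply: (is_deriveZ (2 : R)); apply: is_derive_bigsum => i _.
  exact: (is_derive_dx _ (smooth_dx _ (xis i)) Mq).
have := dx_local a divergence_xi Mq; rewrite E1 E2.
under eq_bigr => i _.
  have [_ -> _] := second_order_equations a i i Mq.
  rewrite eqxx mul1r.
  over.
rewrite big_split /= sumr_const card_ord -[_ *+ N]mulr_natl.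
rewrite (bigD1 a) //= eqxx mul1r big1 => [|i]; last first.
  by rewrite eq_sym => /negbTE ->; rewrite mul0r.
rewrite -(dx_du Mo a phis Mq) => E.
have : (N%:R + 2) * dx a (du phi) q = 0 by lra.
move/eqP; rewrite mulf_eq0 => /orP[|/eqP //].
by rewrite gt_eqF // ltr_wpDl.
Qed.

Definition second_derivatives0 f q : Prop :=
  [/\ forall a b, dx a (dx b f) q = 0, forall a, dx a (du f) q = 0,
      forall a, du (dx a f) q = 0 & du (du f) q = 0].

Lemma second_derivatives_phi q : M q -> second_derivatives0 phi q.
Proof.
move=> Mq; split=> [a b|a|a|].
- by have [] := second_order_equations a b a Mq.
- exact: dx_du_phi0.
- by rewrite -(dx_du Mo a phis Mq); exact: dx_du_phi0.
- pose k := Ordinal (ltnW N1).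
  by have [_ _] := second_order_equations k k k Mq; rewrite eqxx !mul1r.
Qed.

Lemma second_derivatives_xi q i : M q -> second_derivatives0 (xi i) q.
Proof.
have xu y : M y -> du (xi i) y = (fun=> 0 : R) y by move=> My; rewrite du_xi0.
move=> Mq; split=> [a b|a|a|].
- have [_ -> _] := second_order_equations a b i Mq.
  by rewrite -(dx_du Mo b phis Mq) !dx_du_phi0 // !mulr0 addr0.
- by rewrite (dx_local _ xu Mq) dx_cst.
- by rewrite -(dx_du Mo a (xis i) Mq) (dx_local _ xu Mq) dx_cst.
- by rewrite (du_local xu Mq) du_cst.
Qed.

(** The direction is assembled from basis vectors one at a time, continuity of the partial
    derivatives allowing each addition. *)
Lemma derive_dxdu f q (d : xuspace R N) : smooth_on M f -> M q ->
  'D_d f q = \sum_a d.1 a 0 * dx a f q + d.2 * du f q.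
Proof.
move=> fs Mq; apply: (@derive_val _ _ _ _ _ _ _ _).
rewrite [X in is_derive _ X]xu_decomp.
have cts (g : xuspace R N -> R) (k : R) y : smooth_on M g -> M y ->
    {for y, continuous (fun y => k * g y)}.
  by move=> gs My; apply: cvgM; [exact: cvg_cst | exact: smooth_continuous gs My].
apply: (@is_derive_dirD _ _ M f (fun y => d.2 * du f y)
  (fun y => \sum_a d.1 a 0 * dx a f y)) => //.
- elim: (index_enum _) => [|a s IH].
    by rewrite !big_nil; exact: is_derive0.
  rewrite !big_cons addrC [X in is_derive _ _ _ X]addrC.
  apply: (@is_derive_dirD _ _ M f (fun y => d.1 a 0 * dx a f y)
    (fun y => \sum_(a <- s) d.1 a 0 * dx a f y)) => //.
    by move=> y My; apply: is_derive_scale; exact: (is_derive_dx _ fs My).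
  exact: (cts _ _ _ (smooth_dx _ fs) Mq).
- by move=> y My; apply: is_derive_scale; exact: (is_derive_du fs My).
- exact: (cts _ _ _ (smooth_du fs) Mq).
Qed.

(** The mean value theorem, applied to [f] and then to ['D_d f], reduces the remainder to a second
    derivative along the segment, which vanishes. *)
Lemma second_derivatives0_affine f q (d : xuspace R N) : smooth_on M f ->
  (forall y, M y -> second_derivatives0 f y) ->
  (forall s, 0 <= s <= 1 -> M (q + s *: d)) ->
  f (q + d) = f q + (\sum_a d.1 a 0 * dx a f q + d.2 * du f q).
Proof.
move=> fs f0 Mqd.
have Mq : M q by have := Mqd 0; rewrite scale0r addr0 lexx ler01; exact.
have dd0 y : M y -> 'D_d ('D_d f) y = 0.
  move=> My; have [f1 f2 f3 f4] := f0 y My.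
  rewrite (derive_dxdu _ (smooth_derive _ fs) My).
  have -> : du ('D_d f) y = 0.
    have -> : du ('D_d f) y = 'D_d (du f) y.
      by rewrite du.unlock (DD_comm Mo _ _ fs My).
    rewrite (derive_dxdu _ (smooth_du fs) My).
    by rewrite f4 mulr0 addr0 big1 // => a _; rewrite f2 mulr0.
  rewrite mulr0 addr0 big1 // => a _.
  have -> : dx a ('D_d f) y = 'D_d (dx a f) y.
    by rewrite dx.unlock (DD_comm Mo _ _ fs My).
  rewrite (derive_dxdu _ (smooth_dx _ fs) My).
  by rewrite f3 mulr0 addr0 big1 ?mulr0 // => b _; rewrite f1 mulr0.
have [|s s01] := @MVT_direction R _ f ('D_d f) q d 1.
  by move=> s /Mqd; rewrite mulr1 => My; exact: smooth_is_derive fs My.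
rewrite scale1r mul1r mulr1 => E1.
have Mts t : 0 <= t <= 1 -> M (q + (t * s) *: d).
  move=> t01; apply: Mqd; case/andP: s01 => s0 s1; case/andP: t01 => t0 t1.
  by rewrite mulr_ge0 //= mulr_ile1.
have [|t t01] := @MVT_direction R _ ('D_d f) ('D_d ('D_d f)) q d s.
  by move=> t /Mts My; apply: (smooth_is_derive _ _ My); exact: smooth_derive.
rewrite (dd0 _ (Mts t t01)) mulr0 => /eqP; rewrite subr_eq0 => /eqP E2.
by rewrite -(derive_dxdu _ fs Mq) -E2 -E1 [f q + _]addrC subrK.
Qed.

End DeterminingEquations.

(** * Generation of SL(n) by transvections *)

Section Transvections.
Variable R : fieldType.

Inductive transvection_product n : 'M[R]_n -> Prop :=
| transvection_product1 : transvection_product 1%:M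
| transvection_product_one (c : 'cV[R]_n) (r : 'rV[R]_n) :
    r *m c = 0 -> transvection_product (1%:M + c *m r)
| transvection_productM A B : transvection_product A ->
    transvection_product B -> transvection_product (A *m B).

Lemma transvection_product_linv n (A : 'M[R]_n) : transvection_product A ->
  exists2 B, transvection_product B & B *m A = 1%:M.
Proof.
elim=> [|c r rc|A1 A2 _ [B1 g1 E1] _ [B2 g2 E2]].
- by exists 1%:M; [exact: transvection_product1 | rewrite mulmx1].
- exists (1%:M + (- c) *m r).
    by apply: transvection_product_one; rewrite mulmxN rc oppr0.
  rewrite mulmxDl !mulmxDr !mul1mx mulmx1 !mulNmx -mulmxA [r *m _]mulmxA rc.
  by rewrite mul0mx mulmx0 oppr0 addr0 addrK.
- exists (B2 *m B1); first exact: transvection_productM.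
  by rewrite mulmxA -[B2 *m _ *m _]mulmxA E1 mulmx1.
Qed.

Lemma transvection_product_block n (A : 'M[R]_n) : transvection_product A ->
  transvection_product (block_mx 1%:M 0 0 A : 'M[R]_(1 + n)).
Proof.
elim=> [|c r rc|A1 A2 _ g1 _ g2].
- by rewrite -scalar_mx_block; exact: transvection_product1.
- have := @transvection_product_one (1 + n) (col_mx 0 c) (row_mx 0 r).
  rewrite mul_row_col mul0mx add0r mul_col_row !mul0mx !mulmx0 => /(_ rc).
  by rewrite (scalar_mx_block 1 n 1) add_block_mx !addr0.
- have := transvection_productM g1 g2.
  by rewrite mulmx_block !mul1mx !mul0mx !mulmx0 !addr0 !add0r.
Qed.

(** A nonzero entry of the lower block serves as pivot to turn the first entry into 1, and that 1
    then clears the lower block. If the lower block is 0, a preliminary transvection fills it, which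
    takes size at least 2. *)
Lemma transvection_to_e0 n (a : 'cV[R]_(1 + n)) : (0 < n)%N -> a != 0 ->
  exists2 G, transvection_product G & G *m a = col_mx 1%:M 0.
Proof.
move=> n0.
have key (x : 'cV[R]_1) (y : 'cV[R]_n) : y != 0 ->
    exists2 G, transvection_product G & G *m col_mx x y = col_mx 1%:M 0.
  move=> /cV0Pn[i yi].
  (* Chosen so that [r *m y] is 1 - x. *)
  pose r : 'rV[R]_n := ((1 - x 0 0) / y i 0) *: delta_mx 0 i.
  pose G1 : 'M[R]_(1 + n) := 1%:M + col_mx 1%:M 0 *m row_mx 0 r.
  pose G2 : 'M[R]_(1 + n) := 1%:M + col_mx 0 (- y) *m row_mx 1%:M 0.
  have E1 : G1 *m col_mx x y = col_mx 1%:M y.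
    rewrite mulmxDl mul1mx -mulmxA mul_row_col mul0mx add0r mul_col_mx mul1mx.
    rewrite mul0mx add_col_mx addr0; congr col_mx.
    apply/matrixP => k l; rewrite !ord1 -scalemxAl -rowE !mxE eqxx.
    by rewrite divfK // addrC subrK.
  have E2 : G2 *m col_mx 1%:M y = col_mx 1%:M 0.
    rewrite mulmxDl mul1mx -mulmxA mul_row_col mul0mx addr0 mul1mx mulmx1.
    by rewrite add_col_mx addr0 subrr.
  exists (G2 *m G1); last by rewrite -mulmxA E1.
  apply: transvection_productM; apply: transvection_product_one.
    by rewrite mul_row_col mul1mx mul0mx addr0.
  by rewrite mul_row_col mul0mx mulmx0 addr0.
rewrite -[a]vsubmxK; set x := usubmx a; set y := dsubmx a => a0.
have [y0|] := eqVneq y 0; last exact: key.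
have x0 : x 0 0 != 0.
  apply: contra_neq a0 => x00; rewrite y0.
  by rewrite [x](_ : _ = 0) ?col_mx0 //; apply/matrixP => k l; rewrite !ord1 x00 mxE.
pose e : 'cV[R]_n := delta_mx (Ordinal n0) 0.
pose G0 : 'M[R]_(1 + n) := 1%:M + col_mx 0 e *m row_mx ((x 0 0)^-1)%:M 0.
have xE : ((x 0 0)^-1)%:M *m x = 1%:M.
  by apply/matrixP => k l; rewrite !ord1 mul_scalar_mx mxE mulVf // mxE eqxx.
have E0 : G0 *m col_mx x y = col_mx x e.
  rewrite y0 mulmxDl mul1mx -mulmxA mul_row_col mul0mx addr0 xE.
  by rewrite mulmx1 add_col_mx addr0 add0r.
have [|G gG GE] := key x e.
  by apply/cV0Pn; exists (Ordinal n0); rewrite mxE !eqxx oner_eq0.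
exists (G *m G0); last by rewrite -mulmxA E0.
apply: transvection_productM => //; apply: transvection_product_one.
by rewrite mul_row_col mulmx0 mul0mx addr0.
Qed.

Lemma SL_transvection_product n (A : 'M[R]_n) : \det A = 1 ->
  transvection_product A.
Proof.
elim: n A => [A _|n IH A detA].
  by rewrite [A]flatmx0 -[0](flatmx0 1%:M); exact: transvection_product1.
(* In size 1 there is no room for a pivot, but determinant 1 already forces the identity. *)
have [n0|n0] := posnP n.
  rewrite [A](_ : _ = 1%:M); first exact: transvection_product1.
  subst n; rewrite [A]mx11_scalar; congr (_%:M).
  by rewrite -detA [in RHS](mx11_scalar A) det_scalar1.
have a0 : col 0 A != 0.
  apply/eqP => a0; move/eqP: detA; rewrite (expand_det_col _ 0) big1.
    by rewrite eq_sym oner_eq0.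
  by move=> i _; move/matrixP/(_ i 0): a0; rewrite !mxE => ->; rewrite mul0r.
have [G gG GE] := transvection_to_e0 n0 a0.
have [G' gG' GG] := transvection_product_linv gG.
pose B : 'M[R]_(1 + n) := G *m A.
have detG : forall G : 'M[R]_n.+1, transvection_product G -> \det G = 1.
  move=> X; elim=> [|c r rc|A1 A2 _ E1 _ E2]; first exact: det1.
    by rewrite det_1D_mulmx rc mxE addr0.
  by rewrite det_mulmx E1 E2 mulr1.
have detB1 : \det B = 1 by rewrite det_mulmx detG // detA mulr1.
have /matrixP colB : col 0 B = col_mx 1%:M 0 by rewrite /B -GE !colE mulmxA.
rewrite -[A]mul1mx -GG -mulmxA -/B; clearbody B.
have BE : B = block_mx 1%:M (ursubmx B) 0 (drsubmx B).
  rewrite -[LHS]submxK; have l0 : lshift n (0 : 'I_1) = 0 by apply: val_inj.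
  congr block_mx; apply/matrixP => k l; rewrite !mxE (ord1 l) l0.
    by have := colB (lshift n 0) 0; rewrite (ord1 k) col_mxEu !mxE l0.
  by have := colB (rshift 1 k) 0; rewrite col_mxEd !mxE.
have detB : \det (drsubmx B) = 1.
  by move: detB1; rewrite {1}BE det_ublock det1 mul1r.
apply: transvection_productM => //.
(* The remaining first row is split off as one transvection, leaving a smaller matrix of determinant
   1 for the induction. *)
have -> : B = block_mx 1%:M 0 0 (drsubmx B) *m block_mx 1%:M (ursubmx B) 0 1%:M.
  by rewrite mulmx_block !mul1mx !mul0mx !mulmx0 !mulmx1 !addr0 !add0r -BE.
apply: transvection_productM.
  by apply: transvection_product_block; exact: IH.
have := @transvection_product_one (1 + n) (col_mx 1%:M 0) (row_mx 0 (ursubmx B)).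
rewrite mul_row_col mul0mx mulmx0 addr0 => /(_ erefl).
rewrite mul_col_row !mul0mx !mulmx0 mul1mx (scalar_mx_block 1 n 1).
by rewrite add_block_mx !addr0 add0r.
Qed.

End Transvections.

(** * Affine maps realized by the transformations *)

Lemma continuous_bigsum (R : realType) (T : topologicalType) (V : normedModType R)
    I (r : seq I) (f : I -> T -> V) x :
  (forall i, {for x, continuous (f i)}) ->
  {for x, continuous (fun y => \sum_(i <- r) f i y)}.
Proof.
move=> fc; rewrite /prop_for /continuous_at; elim: r => [|i r IH].
  by rewrite big_nil; under eq_fun do rewrite big_nil; exact: cvg_cst.
rewrite big_cons; under eq_fun do rewrite big_cons.
by apply: cvgD; [exact: fc | exact: IH].
Qed.

Section AffineGroup.
Variables (R : realType) (N : nat).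
Implicit Types (L T : xuspace R N -> xuspace R N).

Definition xu_affine (A : 'M[R]_N) (b : 'cV[R]_N) (m : R) (c : 'rV[R]_N) (d : R) :
  xuspace R N -> xuspace R N :=
  fun p => (A *m p.1 + b, m * p.2 + (c *m p.1) 0 0 + d).

Definition MA_affine L : Prop := exists A b m c d,
  [/\ 0 < m, 0 < \det A, \det A ^+ 2 = m ^+ N & L = xu_affine A b m c d].

Lemma MA_affine_id : MA_affine id.
Proof.
exists 1%:M, 0, 1, 0, 0; split; rewrite ?ltr01 ?det1 ?expr1n //.
by apply/funext => -[x u]; rewrite /xu_affine /= mul1mx mul0mx mxE !addr0 mul1r.
Qed.

Lemma MA_affine_comp L1 L2 : MA_affine L1 -> MA_affine L2 -> MA_affine (L1 \o L2).
Proof.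
move=> [A1 [b1 [m1 [c1 [d1 [m1p D1p E1 ->]]]]]] [A2 [b2 [m2 [c2 [d2 [m2p D2p E2 ->]]]]]].
exists (A1 *m A2), (A1 *m b2 + b1), (m1 * m2), (m1 *: c2 + c1 *m A2),
  (m1 * d2 + (c1 *m b2) 0 0 + d1); split.
- exact: mulr_gt0.
- by rewrite det_mulmx mulr_gt0.
- by rewrite det_mulmx !exprMn E1 E2.
apply/funext => -[x u]; rewrite /xu_affine /=; congr pair.
  by rewrite mulmxDr mulmxA addrA.
have addE (X Y : 'M[R]_1) : (X + Y) 0 0 = X 0 0 + Y 0 0 by rewrite mxE.
have scaleE k (X : 'M[R]_1) : (k *: X) 0 0 = k * X 0 0 by rewrite mxE.
by rewrite mulmxDr mulmxDl -scalemxAl mulmxA !addE scaleE; ring.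
Qed.

Lemma xu_affine_continuous A b m c d : continuous (xu_affine A b m c d).
Proof.
move=> p.
apply: (@cvg_pair _ _ _ (nbhs p) (nbhs (A *m p.1 + b))
    (nbhs (m * p.2 + (c *m p.1) 0 0 + d)) _ _ _
    (fun q : xuspace R N => A *m q.1 + b)
    (fun q : xuspace R N => m * q.2 + (c *m q.1) 0 0 + d)).
  apply: cvgD; last exact: cvg_cst.
  have AE (x : 'cV[R]_N) : A *m x = \sum_i x i 0 *: col i A.
    apply/matrixP => k l; rewrite summxE mxE ord1.
    by apply: eq_bigr => i _; rewrite !mxE mulrC.
  rewrite AE; under eq_fun do rewrite AE.
  apply: continuous_bigsum => i; apply: cvgZl.
  apply: (@continuous_comp _ _ _ fst (fun x : 'cV[R]_N => x i 0)).
    exact: cvg_fst.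
  exact: coord_continuous.
apply: cvgD; last exact: cvg_cst.
apply: cvgD.
  by apply: cvgM; [exact: cvg_cst | exact: cvg_snd].
have cE (x : 'cV[R]_N) : (c *m x) 0 0 = \sum_i c 0 i * x i 0 by rewrite mxE.
rewrite cE; under eq_fun do rewrite cE.
apply: continuous_bigsum => i; apply: cvgM; first exact: cvg_cst.
apply: (@continuous_comp _ _ _ fst (fun x : 'cV[R]_N => x i 0)).
  exact: cvg_fst.
exact: coord_continuous.
Qed.

Lemma MA_affine_continuous L : MA_affine L -> continuous L.
Proof. by move=> [A [b [m [c [d [_ _ _ ->]]]]]]; exact: xu_affine_continuous. Qed.

End AffineGroup.

Section Realizable.
Variables (R : realType) (N : nat).
Implicit Types (L T : xuspace R N -> xuspace R N) (p q : xuspace R N).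

(** Quantifying over the transformations [T] already reached makes closure under composition
    immediate. *)
Definition realizable L : Prop := forall p T,
  local_group (MA_transformations R N) p T ->
  local_group (MA_transformations R N) p (L \o T).

Lemma realizable_comp L1 L2 : realizable L1 -> realizable L2 ->
  realizable (L1 \o L2).
Proof. by move=> r1 r2 p T /r2/r1. Qed.

Lemma realizable_act a e : MA_transformations R N (global_oneparam a) ->
  realizable (a e).
Proof.
move=> Ga p T HT; apply: (local_group_comp (e := e) Ga HT) => //.
by near=> q.
Unshelve. all: by end_near. Qed.

Lemma realizable_eq L1 L2 : L1 =1 L2 -> realizable L1 -> realizable L2.
Proof. by move=> /funext ->. Qed.

Lemma realizable_id : realizable id.
Proof. by []. Qed.

Lemma realizable_translation (b : 'cV[R]_N) :
  realizable (fun p => (p.1 + b, p.2)).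
Proof.
rewrite [b]matrix_sum_delta.
elim: (index_enum _) => [|i s IH].
  by apply: realizable_eq realizable_id => -[x u]; rewrite big_nil addr0.
have := realizable_comp IH (realizable_act (b i 0) (MA_g1 R i)).
by apply: realizable_eq => -[x u] /=; rewrite big_cons big_ord1 addrA.
Qed.

Lemma realizable_linear_u (c : 'rV[R]_N) (d : R) :
  realizable (fun p => (p.1, p.2 + (c *m p.1) 0 0 + d)).
Proof.
have r2 := realizable_act d (@MA_g2 R N).
suff r1 : realizable (fun p => (p.1, p.2 + (c *m p.1) 0 0)).
  by have := realizable_comp r2 r1; apply: realizable_eq => -[x u].
apply: (@realizable_eq (fun p => (p.1, p.2 + \sum_i c 0 i * p.1 i 0))).
  by move=> -[x u]; rewrite mxE.
elim: (index_enum _) => [|i s IH].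
  by apply: realizable_eq realizable_id => -[x u]; rewrite big_nil addr0.
have := realizable_comp IH (realizable_act (c 0 i) (MA_g3 R i)).
by apply: realizable_eq => -[x u] /=; rewrite big_cons addrA.
Qed.

Lemma smooth_line (W : normedModType R) (K0 K1 : W) :
  smooth_on setT (fun e : R => K0 + e *: K1).
Proof.
apply: (@smooth_coind _ _ _ setT (fun g => exists K0 K1, g = fun e : R => K0 + e *: K1)).
- exact: openT.
- move=> _ z [k0 [k1 ->]] _; apply: cvgD; first exact: cvg_cst.
  exact: scalel_continuous.
- move=> _ d [k0 [k1 ->]]; exists (fun e : R => d *: k1 + e *: 0).
    by exists (d *: k1), 0.
  move=> z _; rewrite scaler0 addr0.
  apply: line_is_derive.
  have := is_derive_line (t := 0) (f := id) (x := k0 + z *: k1) (v := d *: k1)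
    (is_derive_id _ _).
  congr is_derive; apply/funext => s /=.
  by rewrite scalerDl -addrA scalerA.
- by exists K0, K1.
Qed.

(** Since c r squares to 0, e |-> 1 + e c r is additive in [e]. *)
Lemma transvection_SL_oneparam (c : 'cV[R]_N) (r : 'rV[R]_N) : r *m c = 0 ->
  SL_oneparam_subgroup (fun e => 1%:M + e *: (c *m r)).
Proof.
move=> rc; split; first exact: smooth_line.
- move=> d e; rewrite mulmxDl !mulmxDr !mul1mx mulmx1 -scalemxAl -scalemxAr.
  rewrite mulmxA -[c *m r *m c]mulmxA rc mulmx0 mul0mx !scaler0 addr0.
  by rewrite scalerDl addrA addrAC.
- by move=> e; rewrite scalemxAl det_1D_mulmx -scalemxAr rc scaler0 mxE addr0.
Qed.

Lemma realizable_SL (A : 'M[R]_N) : \det A = 1 ->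
  realizable (fun p => (A *m p.1, p.2)).
Proof.
move/SL_transvection_product; elim=> [|c r rc|A1 A2 _ r1 _ r2].
- by apply: realizable_eq realizable_id => -[x u]; rewrite mul1mx.
- have := realizable_act 1 (MA_g4 (transvection_SL_oneparam rc)).
  by apply: realizable_eq => -[x u]; rewrite scale1r.
- have := realizable_comp r1 r2.
  by apply: realizable_eq => -[x u]; rewrite /= mulmxA.
Qed.

Lemma realizable_MA_affine L : (0 < N)%N -> MA_affine L -> realizable L.
Proof.
move=> N0 [A [b [m [c [d [m0 A0 Am ->]]]]]].
(* With this parameter, g5 multiplies [u] by m and has linear part of determinant m^(N/2) = det A,
   so that A D^-1 lies in SL(N). *)
pose i0 := Ordinal N0; pose e := ln m / 2.
pose D : 'M[R]_N := diag_mx (\row_j (if j == i0 then expR (N%:R * e) else 1)).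
have e2 : expR (2 * e) = m by rewrite /e mulrC divfK // lnK.
have detD : \det D = expR (N%:R * e).
  rewrite det_diag (bigD1 i0) //= mxE eqxx big1 ?mulr1 // => j /negbTE ji.
  by rewrite mxE ji.
have detDA : \det D = \det A.
  rewrite detD; apply: (@pexpIrn _ 2) => //; rewrite ?nnegrE ?expR_ge0 ?ltW //.
  by rewrite Am -[in RHS]e2 -(expRM_natl 2) -(expRM_natl N) mulrCA.
have Du : D \in unitmx by rewrite unitmxE unitfE detD gt_eqF ?expR_gt0.
have Au : A \in unitmx by rewrite unitmxE unitfE gt_eqF.
have r5 := realizable_act e (MA_g5 R i0).
have r4 : realizable (fun p => ((A *m invmx D) *m p.1, p.2)).
  apply: realizable_SL; rewrite det_mulmx det_inv -detDA mulfV //.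
  by rewrite detD gt_eqF ?expR_gt0.
(* The linear form is added after [x] has become A x, hence the factor A^-1. *)
have r3 := realizable_linear_u (c *m invmx A) d.
have r1 := realizable_translation b.
have := realizable_comp r1 (realizable_comp r3 (realizable_comp r4 r5)).
apply: realizable_eq => -[x u]; rewrite /xu_affine /=.
have -> : \col_j (if j == i0 then expR (N%:R * e) * x j 0 else x j 0) = D *m x.
  apply/matrixP => j k; rewrite mul_diag_mx !mxE ord1.
  by case: eqP; rewrite ?mul1r.
rewrite !mulmxA -[A *m _ *m D]mulmxA mulVmx // mulmx1.
by rewrite -[c *m _ *m A]mulmxA mulVmx // mulmx1 -[c *m _ *m D]mulmxA mulVmx // mulmx1 e2.
Qed.

Lemma MA_affine_local_group L T p : (0 < N)%N -> MA_affine L ->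
  (\forall q \near p, T q = L q) -> local_group (MA_transformations R N) p T.
Proof.
move=> N0 /(realizable_MA_affine N0) rL TL.
have /rL HL : local_group (MA_transformations R N) p id.
  by apply: local_group_id; near=> q.
(* A trivial translation of [u] serves as a step at which [L] may be replaced by a map equal to it
   only near [p]. *)
apply: (local_group_comp (e := 0) (MA_g2 R N) HL) => //.
by apply: filterS TL => q ->; rewrite /= addr0; case: (L q).
Unshelve. all: by end_near. Qed.

End Realizable.

(** * Linear differential equations and local flows *)

Section LinearODE.
Variable R : realType.

(* With E the sum of the squares, E' <= K E, so E exp(-K t) is nonincreasing. *)
Lemma linear_ode_unique_right n (B : 'M[R]_n) (w : 'I_n -> R -> R) (d : R) :
  (forall h, `|h| < d ->
    forall i, is_derive h (1 : R) (w i) (\sum_j B i j * w j h)) ->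
  (forall i, w i 0 = 0) -> forall h, 0 <= h < d -> forall i, w i h = 0.
Proof.
move=> Hw w0 h /andP[h0 hd].
pose E t := \sum_i w i t * w i t.
(* Each product |w_i w_j| is at most E, so twice the sum of the |B_ij| bounds the growth rate. *)
pose K := 2 * \sum_i \sum_j `|B i j|.
pose dE t := \sum_i (w i t * (\sum_j B i j * w j t) + (\sum_j B i j * w j t) * w i t).
have HE t : `|t| < d -> is_derive t (1 : R) E (dE t).
  move=> td; apply: is_derive_bigsum => i _.
  by apply: is_derive_mul; exact: Hw.
have wE t i j : `|w i t * w j t| <= E t.
  have le_E k : w k t ^+ 2 <= E t.
    rewrite /E (bigD1 k) //= -expr2 lerDl sumr_ge0 // => l _.
    by rewrite -expr2 sqr_ge0.
  have := sqr_ge0 (`|w i t| - `|w j t|); rewrite normrM.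
  have := le_E i; have := le_E j.
  rewrite -(normr_id (w i t)) -(normr_id (w j t)) -![w _ t ^+ 2]real_normK ?num_real //.
  rewrite !normr_id; move: (`|w i t|) (`|w j t|) => x y; nra.
have dEK t : dE t <= K * E t.
  rewrite /K -mulrA big_distrl /= mulr_sumr; apply: ler_sum => i _.
  set S := \sum_j B i j * w j t.
  rewrite (_ : _ + _ = 2 * (w i t * S)); last by ring.
  rewrite ler_pM2l // big_distrl big_distrr /=.
  apply: ler_sum => j _; rewrite mulrCA.
  apply: le_trans (ler_norm _) _; rewrite normrM.
  by apply: ler_wpM2l.
pose g t := E t * expR (- K * t).
pose dg t := E t * (expR (- K * t) * - K) + dE t * expR (- K * t).
have Hg t : `|t| < d -> is_derive t (1 : R) g (dg t).
  move=> td; apply: is_derive_mul; first exact: HE.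
  apply: (@is_derive1_comp _ expR ( *%R (- K))).
  have := is_deriveZ (- K) (is_derive_id t (1 : R)).
  by rewrite [_ *: 1]mulr1.
have dg0 t : dg t <= 0.
  rewrite /dg (_ : _ + _ = (dE t - K * E t) * expR (- K * t)); last by ring.
  by rewrite mulr_le0_ge0 ?expR_ge0 // subr_le0.
have Hin t : 0 <= t <= h -> `|t| < d.
  by move=> /andP[t0 th]; rewrite ger0_norm // (le_lt_trans th).
have [||t th Eg] := @MVT_segment R g dg 0 h h0.
- by move=> t; rewrite in_itv /= => /andP[t0 th]; apply: Hg; apply: Hin; rewrite !ltW.
- apply: derivable_within_continuous => t; rewrite in_itv /= => th.
  by have [] := Hg t (Hin t th).
have g0 : g 0 = 0 by rewrite /g /E big1 ?mul0r // => i _; rewrite w0 mul0r.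
have gh : g h <= 0.
  move: Eg; rewrite g0 !subr0 => ->; exact: mulr_le0_ge0.
have Eh : E h <= 0 by move: gh; rewrite /g pmulr_lle0 ?expR_gt0.
move=> i; apply/eqP; rewrite -sqrf_eq0 expr2 -normr_le0.
exact: le_trans (wE h i i) Eh.
Qed.

(** Negative times follow by time reversal, which replaces [B] by [- B]. *)
Lemma linear_ode_unique n (B : 'M[R]_n) (w : 'I_n -> R -> R) (d : R) :
  (forall h, `|h| < d ->
    forall i, is_derive h (1 : R) (w i) (\sum_j B i j * w j h)) ->
  (forall i, w i 0 = 0) -> forall h, `|h| < d -> forall i, w i h = 0.
Proof.
move=> Hw w0 h hd i; have [h0|h0] := leP 0 h.
  by apply: (linear_ode_unique_right Hw) => //; rewrite h0 -(ger0_norm h0).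
have := @linear_ode_unique_right n (- B) (fun i t => w i (- t)) d _ _ (- h) _ i.
rewrite opprK; apply.
- move=> t td k.
  have Hk : is_derive (- t) (1 : R) (w k) (\sum_j B k j * w j (- t)).
    by apply: Hw; rewrite normrN.
  have := @is_derive1_comp R (w k) -%R t _ _ Hk (is_deriveNid t (1 : R)).
  rewrite mulrN1; congr is_derive; rewrite -sumrN.
  by apply: eq_bigr => j _; rewrite mxE mulNr.
- by move=> k; rewrite oppr0.
- by rewrite oppr_ge0 ltW //= -ltr0_norm.
Qed.

Lemma scalar_ode_unique (m : R) (w : R -> R) (d : R) :
  (forall h, `|h| < d -> is_derive h (1 : R) w (m * w h)) ->
  w 0 = 0 -> forall h, `|h| < d -> w h = 0.
Proof.
move=> Hw w0 h hd.
apply: (@linear_ode_unique 1 m%:M (fun _ => w) d _ _ h hd 0) => // t td i.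
by rewrite big_ord1 mxE !ord1 eqxx mulr1n; exact: Hw.
Qed.

End LinearODE.

(** * Velocity of a local action *)

Section Flow.
Variables (R : realType) (N : nat) (G : oneparam R N).
Hypothesis GA : local_action G.
Let v := generator G.
Implicit Types (p q r : xuspace R N).

Lemma carrier_open : open (carrier G).
Proof.
apply: (@open_comp _ _ (fun p => (0 : R, p)) (dom G)); last exact: dom_open GA.
by move=> p _; exact: continuous_pairl.
Qed.

(** The orbit derivative is the derivative of the joint map in the direction (1, 0). Its existence
    ensures that [generator] is not a default value of [derive1]. *)
Lemma generatorE p : carrier G p ->
  is_derive (0 : R) (1 : R) (fun e => act G e p)
    ('D_((1, 0) : R * xuspace R N) (fun z => act G z.1 z.2) (0, p)) /\
  'D_((1, 0) : R * xuspace R N) (fun z => act G z.1 z.2) (0, p) = v p.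
Proof.
move=> cp; have := smooth_is_derive ((1, 0) : R * xuspace R N) (act_smooth GA) cp.
move=> H; have {H}Hd : is_derive (0 : R) (1 : R) (fun e => act G e p)
    ('D_((1, 0) : R * xuspace R N) (fun z => act G z.1 z.2) (0, p)).
  by apply: is_derive_transport H => h /=; rewrite scaler0 add0r.
split; first exact: Hd.
rewrite -[LHS](@derive_val _ _ _ _ _ _ _ Hd); exact: (esym (derive1E _ _)).
Qed.

Lemma is_derive_generator p : carrier G p ->
  is_derive (0 : R) (1 : R) (fun e => act G e p) (v p).
Proof. by move=> /generatorE[+ <-]. Qed.

Lemma generator_smooth : smooth_on (carrier G) v.
Proof.
have := smooth_slice (dom_open GA)
  (smooth_derive ((1, 0) : R * xuspace R N) (act_smooth GA)).
apply: smooth_eq; first exact: carrier_open.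
by move=> p /generatorE[].
Qed.

Lemma open_dom_time q : open [set t : R | dom G (t, q)].
Proof.
apply: (@open_comp _ _ (fun t : R => (t, q)) (dom G)); last exact: dom_open GA.
by move=> t _; exact: continuous_pairr.
Qed.

(** For small s the group law gives act (s + h) q = act s (act h q), so the velocity at time [h] is
    the initial velocity at the moved point. Openness of [dom G] provides the required domain
    conditions. *)
Lemma flow_is_derive h q : dom G (h, q) ->
  is_derive h (1 : R) (fun t => act G t q) (v (act G h q)).
Proof.
move=> dh; have [cq cy] := dom_carrier GA dh.
have H0 := is_derive_generator cy.
have shift_open : open [set s : R | dom G (s + h, q)].
  apply: (@open_comp _ _ (fun s : R => s + h) [set t : R | dom G (t, q)]).
    by move=> s _; apply: cvgD; [exact: cvg_id | exact: cvg_cst].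
  exact: open_dom_time.
have := near_is_derive (g := fun s => act G (s + h) q)
  (openI (@open_dom_time (act G h q)) shift_open) _ _ H0.
move=> H.
have {H} : is_derive (0 : R) (1 : R) (fun s => act G (s + h) q) (v (act G h q)).
  apply: H => [s [/= ds dsh]|]; last by split => //=; rewrite add0r.
  by rewrite (actD GA).
by apply: is_derive_transport => t; rewrite addr0.
Qed.

Lemma act_continuous h q : dom G (h, q) ->
  {for ((h, q) : R * xuspace R N), continuous (fun z : R * xuspace R N => act G z.1 z.2)}.
Proof. exact: (smooth_continuous (act_smooth GA)). Qed.

End Flow.

(** * The flow of a symmetry is affine *)

Section SymmetryFlow.
Variables (R : realType) (N : nat) (G : oneparam R N).
Hypothesis N1 : (1 < N)%N.
Hypothesis GS : oneparam_symmetry 2 (monge_ampere R N) G.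
Let GA : local_action G := GS.1.
Let v := generator G.
Implicit Types (p q r : xuspace R N).

Let phi : xuspace R N -> R := fun p => (v p).2.
Let xi i : xuspace R N -> R := fun p => (v p).1 i 0.

Lemma generator_phi_smooth : smooth_on (carrier G) phi.
Proof. exact: (smooth_snd (carrier_open GA) (generator_smooth GA)). Qed.

Lemma generator_xi_smooth i : smooth_on (carrier G) (xi i).
Proof.
exact: (smooth_coord _ _ (carrier_open GA)
  (smooth_fst (carrier_open GA) (generator_smooth GA))).
Qed.

(** A ball in the carrier contains its segments to the centre, so the first-order expansion is exact
    there. The trace relation is the divergence equation at [r]. *)
Lemma generator_affine r : carrier G r ->
  exists (B : 'M[R]_N) (c : 'I_N -> R) (m : R),
  N%:R * m = 2 * \tr B /\
  exists2 eps, 0 < eps & forall q, `|q - r| < eps -> 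
    (forall i, xi i q = xi i r + \sum_a B i a * (q.1 a 0 - r.1 a 0)) /\
    phi q = phi r + (\sum_a c a * (q.1 a 0 - r.1 a 0) + m * (q.2 - r.2)).
Proof.
move=> cr; have Mo := carrier_open GA.
have ps := generator_phi_smooth; have xs := generator_xi_smooth.
exists (\matrix_(i, a) dx a (xi i) r), (fun a => dx a phi r), (du phi r); split.
  rewrite (divergence_xi N1 Mo ps xs GS.2 cr); congr (_ * _).
  by apply: eq_bigr => i _; rewrite mxE.
have /nbhs_normP[eps /= eps0 Heps] : \forall q \near r, carrier G q.
  exact: open_nbhs_nbhs.
exists eps => // q qr.
have seg s : 0 <= s <= 1 -> carrier G (r + s *: (q - r)).
  move=> /andP[s0 s1]; apply: Heps => /=.
  rewrite opprD addNKr normrN normrZ ger0_norm //.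
  by apply: le_lt_trans qr; rewrite ler_piMl.
have E f : smooth_on (carrier G) f ->
    (forall y, carrier G y -> second_derivatives0 f y) ->
    f q = f r + (\sum_a (q - r).1 a 0 * dx a f r + (q - r).2 * du f r).
  move=> fs f0; rewrite -(second_derivatives0_affine Mo fs f0 seg).
  by congr f; rewrite addrC subrK.
split=> [i|].
  rewrite (E _ (xs i)); last by move=> y; exact: (second_derivatives_xi N1 Mo ps xs GS.2).
  rewrite (du_xi0 N1 Mo ps xs GS.2 i cr) mulr0 addr0; congr (_ + _).
  by apply: eq_bigr => a _; rewrite !mxE mulrC.
rewrite (E _ ps); last by move=> y; exact: (second_derivatives_phi N1 Mo ps xs GS.2).
congr (_ + (_ + _)); last by rewrite mulrC.
by apply: eq_bigr => a _; rewrite !mxE mulrC.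
Qed.

Lemma local_flow_domain r eps : carrier G r -> 0 < eps ->
  exists2 rho, 0 < rho & forall h q, `|h| < rho -> `|q - r| < rho ->
    dom G (h, q) /\ `|act G h q - r| < eps.
Proof.
move=> cr eps0.
have : \forall z \near ((0, r) : R * xuspace R N),
    dom G z /\ `|r - act G z.1 z.2| < eps.
  apply: filterI; first exact: (open_nbhs_nbhs (conj (dom_open GA) cr)).
  have := act_continuous GA cr; rewrite /prop_for /continuous_at /=.
  by rewrite (act0 GA cr) => /cvgrPdist_lt; apply.
move=> [[/= U V] [/nbhs_normP[u /= u0 Uu] /nbhs_normP[w /= w0 Vw]] UV].
exists (Num.min u w) => [|h q]; first by rewrite lt_min u0.
rewrite !lt_min => /andP[hu _] /andP[_ qw].
have [] := UV (h, q).
  split=> /=; first by apply: Uu => /=; rewrite sub0r normrN.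
  by apply: Vw => /=; rewrite distrC.
by rewrite distrC.
Qed.

(** Difference quotients of the trajectories of [r] and of its N displacements [rk k] supply the
    linear part. The affine formula for any other starting point then solves the same linear
    equation with the same initial value. *)
Lemma local_flow r : carrier G r ->
  exists2 rho, 0 < rho & forall h, `|h| < rho ->
    exists2 L, MA_affine L &
      forall q, `|q - r| < rho -> dom G (h, q) /\ act G h q = L q.
Proof.
move=> cr; have [B [c [m [trB [eps eps0 Hv]]]]] := generator_affine cr.
have [rho rho0 Hrho] := local_flow_domain cr eps0.
exists rho => // h hrho.
pose X q i t := (act G t q).1 i 0; pose U q t := (act G t q).2.
have dX q t i : `|t| < rho -> `|q - r| < rho -> is_derive t (1 : R) (X q i)
    (xi i r + \sum_a B i a * (X q a t - r.1 a 0)).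
  move=> tr qr; have [dt near_r] := Hrho t q tr qr.
  have := flow_is_derive GA dt; have [/(_ i) <- _] := Hv _ near_r.
  by move=> /is_derive_fst/(is_derive_coord i 0).
have dU q t : `|t| < rho -> `|q - r| < rho -> is_derive t (1 : R) (U q)
    (phi r + (\sum_a c a * (X q a t - r.1 a 0) + m * (U q t - r.2))).
  move=> tr qr; have [dt near_r] := Hrho t q tr qr.
  have := flow_is_derive GA dt; have [_ <-] := Hv _ near_r.
  by move=> /is_derive_snd.
have r0 : `|0 : R| < rho by rewrite normr0.
have rr : `|r - r| < rho by rewrite subrr normr0.
(* The sum bounds all the norms [|ex R k|] at once, so one [eta] keeps every auxiliary starting
   point within [rho] of [r]. *)
pose eta := rho / (1 + \sum_k `|ex R k : xuspace R N|).
have S0 : 0 < 1 + \sum_k `|ex R k : xuspace R N|.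
  by rewrite ltr_pwDl // sumr_ge0.
have eta0 : 0 < eta by rewrite divr_gt0.
pose rk k := r + eta *: ex R k.
have rkr k : `|rk k - r| < rho.
  rewrite /rk addrC addKr normrZ gtr0_norm // /eta mulrAC ltr_pdivrMr //.
  rewrite ltr_pM2l // (bigD1 k) //= addrCA ltrDl ltr_pwDl // sumr_ge0 //.
pose A t : 'M[R]_N := \matrix_(i, k) ((X (rk k) i t - X r i t) / eta).
pose gam k t := (U (rk k) t - U r t) / eta.
have X0 q i : `|q - r| < rho -> X q i 0 = q.1 i 0.
  move=> qr; have [d0 _] := Hrho 0 q r0 qr; by rewrite /X (act0 GA).
have U0 q : `|q - r| < rho -> U q 0 = q.2.
  move=> qr; have [d0 _] := Hrho 0 q r0 qr; by rewrite /U (act0 GA).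
have A0 : A 0 = 1%:M.
  apply/matrixP => i k; rewrite !mxE !X0 //= !mxE andbT [r.1 i 0 + _]addrC addrK.
  by rewrite [eta * _]mulrC mulfK // gt_eqF.
have gam0 k : gam k 0 = 0.
  by rewrite /gam !U0 //= scaler0 addr0 subrr mul0r.
have dA t i k : `|t| < rho ->
    is_derive t (1 : R) (fun t => A t i k) (\sum_a B i a * A t a k).
  move=> tr; under eq_fun do rewrite mxE.
  have := is_derive_mul (is_derive_sub (dX (rk k) t i tr (rkr k)) (dX r t i tr rr))
    (is_derive_cst eta^-1 t (1 : R)).
  congr is_derive; rewrite mulr0 add0r opprD addrACA subrr add0r -sumrB big_distrl /=.
  by apply: eq_bigr => a _; rewrite mxE; ring.
have EX q t i : `|t| < rho -> `|q - r| < rho ->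
    X q i t = X r i t + \sum_k A t i k * (q.1 k 0 - r.1 k 0).
  move=> tr qr.
  suff : X q i t - X r i t - \sum_k A t i k * (q.1 k 0 - r.1 k 0) = 0.
    by move=> /eqP; rewrite subr_eq0 subr_eq addrC => /eqP.
  apply: (@linear_ode_unique R N B (fun i t =>
     X q i t - X r i t - \sum_k A t i k * (q.1 k 0 - r.1 k 0)) rho) => // [s sr j|j].
    have := is_derive_sub (is_derive_sub (dX q s j sr qr) (dX r s j sr rr))
      (is_derive_bigsum (index_enum _) (P := xpredT) (fun k _ =>
        is_derive_mul (dA s j k sr) (is_derive_cst (q.1 k 0 - r.1 k 0) s (1 : R)))).
    congr is_derive; rewrite opprD addrACA subrr add0r -sumrB.
    under [in RHS]eq_bigr do rewrite mulrBr big_distrr /=.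
    rewrite [in RHS]sumrB [in RHS]exchange_big /=; congr (_ - _).
      by apply: eq_bigr => a _; ring.
    apply: eq_bigr => k _; rewrite mulr0 add0r big_distrl /=.
    by apply: eq_bigr => a _; rewrite mulrA.
  rewrite !X0 // A0 (bigD1 j) //= mxE eqxx mul1r big1 ?addr0 ?subrr //.
  by move=> k; rewrite eq_sym mxE => /negbTE ->; rewrite mul0r.
(* By [EX] the [x]-terms cancel in the derivative of the discrepancy, which therefore satisfies w' =
   m w. *)
have EU q t : `|t| < rho -> `|q - r| < rho ->
    U q t = U r t + \sum_k gam k t * (q.1 k 0 - r.1 k 0) + expR (m * t) * (q.2 - r.2).
  move=> tr qr.
  suff : U q t - U r t - \sum_k gam k t * (q.1 k 0 - r.1 k 0)
     - expR (m * t) * (q.2 - r.2) = 0 by move=> E0; lra.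
  apply: (@scalar_ode_unique R m (fun t => U q t - U r t
     - \sum_k gam k t * (q.1 k 0 - r.1 k 0) - expR (m * t) * (q.2 - r.2)) rho)
    => // [s sr|].
    have dgam k : is_derive s (1 : R) (gam k)
        (\sum_a c a * A s a k + m * gam k s).
      have := is_derive_mul (is_derive_sub (dU (rk k) s sr (rkr k)) (dU r s sr rr))
        (is_derive_cst eta^-1 s (1 : R)).
      congr is_derive; rewrite mulr0 add0r.
      have -> : \sum_a c a * A s a k = \sum_a c a * (X (rk k) a s - X r a s) / eta.
        by apply: eq_bigr => a _; rewrite mxE mulrA.
      rewrite -big_distrl /= /gam.
      have -> : \sum_a c a * (X (rk k) a s - X r a s) =
         \sum_a c a * (X (rk k) a s - r.1 a 0) - \sum_a c a * (X r a s - r.1 a 0).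
        by rewrite -sumrB; apply: eq_bigr => a _; ring.
      ring.
    have := is_derive_sub (is_derive_sub (is_derive_sub (dU q s sr qr) (dU r s sr rr))
      (is_derive_bigsum (index_enum _) (P := xpredT) (fun k _ =>
        is_derive_mul (dgam k) (is_derive_cst (q.1 k 0 - r.1 k 0) s (1 : R)))))
      (is_derive_mul (is_derive_expR_line m s) (is_derive_cst (q.2 - r.2) s (1 : R))).
    congr is_derive.
    have -> : \sum_a c a * (X q a s - r.1 a 0) = \sum_a c a * (X r a s - r.1 a 0)
        + \sum_k (\sum_a c a * A s a k) * (q.1 k 0 - r.1 k 0).
      under [X in _ = _ + X]eq_bigr do rewrite big_distrl /=.
      rewrite [in RHS]exchange_big -big_split /=; apply: eq_bigr => a _.
      rewrite EX // addrAC mulrDr mulr_sumr; congr (_ + _).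
      by apply: eq_bigr => k _; rewrite mulrA.
    under [X in _ - X - _]eq_bigr do rewrite mulr0 add0r mulrDl -mulrA.
    rewrite big_split -big_distrr /= mulr0; ring.
  rewrite !U0 // mulr0 expR0 mul1r big1 ?subr0; first by rewrite subrr.
  by move=> k _; rewrite gam0 mul0r.
(* Liouville's formula: by Jacobi's formula det A solves w' = tr B w, as does the exponential. *)
have detA : \det (A h) = expR (\tr B * h).
  apply/eqP; rewrite -subr_eq0; apply/eqP.
  apply: (@scalar_ode_unique R (\tr B) (fun t => \det (A t) - expR (\tr B * t)) rho)
    => // [s sr|].
    have dd := @is_derive_det R N A (\matrix_(i, j) \sum_a B i a * A s a j) s 1.
    have {}dd := is_derive_sub (dd _) (is_derive_expR_line (\tr B) s).
    have H : is_derive s (1 : R) (fun t => \det (A t) - expR (\tr B * t))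
      (\sum_i \sum_j (\matrix_(i, j) \sum_a B i a * A s a j) i j * cofactor (A s) i j
        - \tr B * expR (\tr B * s)).
      by apply: dd => i j; rewrite mxE; exact: dA.
    move: H; congr is_derive; rewrite mulrBr; congr (_ - _).
    rewrite big_distrl /=; apply: eq_bigr => i _.
    under eq_bigr do rewrite mxE big_distrl /=.
    rewrite exchange_big /=.
    under eq_bigr do under eq_bigr do rewrite -mulrA.
    under eq_bigr do rewrite -big_distrr /=.
    have AC a : \sum_j A s a j * cofactor (A s) i j = (a == i)%:R * \det (A s).
      have := congr1 (fun X : 'M[R]_N => X a i) (mul_mx_adj (A s)).
      rewrite mxE [RHS]mxE => E; rewrite mulr_natl -E; apply: eq_bigr => j _.
      by congr (_ * _); rewrite [RHS]mxE.
    under eq_bigr do rewrite AC.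
    rewrite (bigD1 i) //= eqxx mul1r big1 ?addr0 // => a /negbTE ->.
    by rewrite mul0r mulr0.
  by rewrite A0 det1 mulr0 expR0 subrr.
pose A' := A h; pose gr : 'rV[R]_N := \row_k gam k h.
(* The constant terms are fixed by requiring that [r] be sent to [act G h r]. *)
exists (xu_affine A' (\col_i (X r i h) - A' *m r.1) (expR (m * h)) gr
   (U r h - (gr *m r.1) 0 0 - expR (m * h) * r.2)).
  exists A', (\col_i (X r i h) - A' *m r.1), (expR (m * h)), gr,
    (U r h - (gr *m r.1) 0 0 - expR (m * h) * r.2).
  split => //; rewrite ?expR_gt0 // /A' detA ?expR_gt0 //.
  rewrite -(expRM_natl 2) -(expRM_natl N) !mulrA trB mulrC.
  by [].
move=> q qr; have [dq _] := Hrho h q hrho qr; split => //.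
rewrite [act G h q]surjective_pairing /xu_affine; congr pair.
  apply/matrixP => i j; rewrite ord1 -/(X q i h) EX // !mxE.
  under eq_bigr do rewrite mulrBr.
  by rewrite sumrB; ring.
rewrite -/(U q h) EU // !mxE; under eq_bigr do rewrite mulrBr.
rewrite sumrB.
under [X in _ = _ + X + _]eq_bigr do rewrite mxE.
under [X in _ = _ + (_ - X - _)]eq_bigr do rewrite mxE.
ring.
Qed.

Lemma flow_locally_affine e p : dom G (e, p) ->
  exists2 L, MA_affine L & \forall q \near p, act G e q = L q.
Proof.
move=> dep.
have near_dom t : dom G (t, p) -> \forall q \near p, dom G (t, q).
  move=> dt.
  have /open_nbhs_nbhs : open_nbhs p [set q | dom G (t, q)].
    split=> //; apply: (@open_comp _ _ (fun q => (t, q)) (dom G)).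
      by move=> q _; exact: continuous_pairl.
    exact: dom_open GA.
  by [].
have near_act t r rho : 0 < rho -> dom G (t, p) -> `|act G t p - r| < rho ->
    \forall q \near p, `|act G t q - r| < rho.
  move=> rho0 dt tr.
  have tc : {for p, continuous (act G t)}.
    apply: (@continuous_comp _ _ _ (fun q : xuspace R N => ((t, q) : R * xuspace R N))
      (fun z : R * xuspace R N => act G z.1 z.2) p); last exact: (act_continuous GA dt).
    exact: continuous_pairl.
  have e0 : 0 < rho - `|act G t p - r| by rewrite subr_gt0.
  move/cvgrPdist_lt : tc => /(_ _ e0); apply: filterS => q Hq.
  rewrite -(subrK (act G t p) (act G t q)) -addrA.
  apply: le_lt_trans (ler_normD _ _) _.
  by rewrite -ltrBrDr distrC.
pose I := [set t : R | dom G (t, p)].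
have Io : open I by exact: (open_dom_time GA).
pose S t := I t /\ exists2 L, MA_affine L & \forall q \near p, act G t q = L q.
(* Around [act G t p] the local flow carries time s1 to time s2 by an affine map. The statement is
   symmetric in s1 and s2, so it yields openness both of [S] and of its complement in [I]. *)
have step t : I t -> exists2 U, nbhs t U & forall s1 s2, U s1 -> U s2 -> S s1 -> S s2.
  move=> It; have [_ cr] := dom_carrier GA It.
  have [rho rho0 Hrho] := local_flow cr.
  have ac : \forall s \near t, `|act G s p - act G t p| < rho.
    have tc : {for t, continuous (fun s => act G s p)}.
      apply: (@continuous_comp _ _ _ (fun s : R => ((s, p) : R * xuspace R N))
        (fun z : R * xuspace R N => act G z.1 z.2) t); last exact: (act_continuous GA It).
      exact: continuous_pairr.
    by move/cvgrPdist_lt : tc => /(_ _ rho0); apply: filterS => s; rewrite distrC.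
  (* Half of [rho], so that two such times differ by less than [rho]. *)
  have tt : \forall s \near t, `|t - s| < rho / 2.
    have /cvgrPdist_lt Ht : id s @[s --> t] --> t by exact: cvg_id.
    by apply: Ht; rewrite divr_gt0.
  exists [set s | [/\ I s, `|act G s p - act G t p| < rho & `|t - s| < rho / 2]].
    by near=> s; split; near: s; [exact: open_nbhs_nbhs | exact: ac | exact: tt].
  move=> s1 s2 [Is1 a1 t1] [Is2 a2 t2] [_ [L1 M1 H1]]; split => //.
  have hr : `|s2 - s1| < rho.
    rewrite (_ : s2 - s1 = (t - s1) - (t - s2)); last by ring.
    by apply: le_lt_trans (ler_normB _ _) _; rewrite [rho]splitr ltrD.
  have [L M HL] := Hrho _ hr.
  exists (L \o L1); first exact: MA_affine_comp.
  near=> q.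
  have d1 : dom G (s1, q) by near: q; exact: near_dom.
  have d2 : dom G (s2, q) by near: q; exact: near_dom.
  have n1 : `|act G s1 q - act G t p| < rho by near: q; exact: near_act.
  have E1 : act G s1 q = L1 q by near: q.
  have [d3 E3] := HL _ n1.
  rewrite /= -E1 -E3 (actD GA) ?subrK //.
have I0 : I 0 by have [] := dom_carrier GA dep.
have S0 : S 0.
  split=> //; exists id; first exact: MA_affine_id.
  by apply: filterS (near_dom 0 I0) => q; exact: (act0 GA).
have So : open [set t | S t].
  rewrite openE => t St; have [U Ut HU] := step t St.1; have U0 := nbhs_singleton Ut.
  by apply: filterS Ut => s Us; apply: (HU t s) => //.
have Do : open [set t | I t /\ ~ S t].
  rewrite openE => t [It nSt]; have [U Ut HU] := step t It; have U0 := nbhs_singleton Ut.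
  have IU : nbhs t I by exact: open_nbhs_nbhs.
  apply: filterS (filterI Ut IU) => s [Us Is]; split=> // Ss; apply: nSt.
  by apply: (HU s t) => //.
have : connected I by apply/connected_intervalP; exact: (dom_interval GA).
move=> /(_ [set t | S t]) H; suff : [set t | S t] e by case.
have -> : [set t | S t] = I; last by [].
apply: H.
- by exists 0.
- exists [set t | S t] => //.
  by apply/seteqP; split=> t; [move=> St; split=> //; exact: St.1|case].
- exists (~` [set t | I t /\ ~ S t]); first exact: open_closedC.
  apply/seteqP; split=> t; first by move=> St; split; [exact: St.1|case].
  by move=> [It /= nn]; apply: contrapT => nS; apply: nn.
Unshelve. all: by end_near. Qed.

End SymmetryFlow.

(** * Affine vector fields and global actions *)

Section AffineSymmetries.
Variables (R : realType) (N : nat).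

Definition xu_form (c : 'I_N -> R) (m k : R) : xuspace R N -> R :=
  fun p => \sum_i c i * p.1 i 0 + m * p.2 + k.

Lemma smooth_coord_x i : smooth_on setT (fun p : xuspace R N => p.1 i 0).
Proof. exact: (smooth_coord _ _ openT (smooth_fst openT (@smooth_id _ _))). Qed.

Lemma smooth_coord_u : smooth_on setT (fun p : xuspace R N => p.2).
Proof. exact: (smooth_snd openT (@smooth_id _ _)). Qed.

Lemma xu_form_smooth c m k : smooth_on setT (xu_form c m k).
Proof.
apply: smooth_add; [exact: openT| |exact: smooth_cst].
apply: smooth_add; first exact: openT.
  apply: smooth_sum => i; apply: smooth_mul; first exact: smooth_cst.
  exact: smooth_coord_x.
by apply: smooth_mul; [exact: smooth_cst | exact: smooth_coord_u].
Qed.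

Lemma is_derive_xu_form c m k p (d : xuspace R N) :
  is_derive p d (xu_form c m k) (\sum_i c i * d.1 i 0 + m * d.2).
Proof.
rewrite -[X in is_derive _ _ _ X]addr0.
apply: is_derive_add.
apply: is_derive_add.
  apply: is_derive_bigsum => i _; apply: is_deriveZ.
  exact: (is_derive_coord _ _ (is_derive_fst (is_derive_id p d))).
by apply: is_deriveZ; exact: (is_derive_snd (is_derive_id p d)).
Qed.

Lemma dx_xu_form a c m k : dx a (xu_form c m k) = fun=> c a.
Proof.
apply/funext => p; rewrite dx.unlock.
rewrite (@derive_val _ _ _ _ _ _ _ (is_derive_xu_form _ _ _ _ _)).
rewrite /= mulr0 addr0 (bigD1 a) //= mxE !eqxx mulr1 big1 ?addr0 // => i /negbTE ia.
by rewrite mxE ia mulr0.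
Qed.

Lemma du_xu_form c m k : du (xu_form c m k) = fun=> m.
Proof.
apply/funext => p; rewrite du.unlock.
rewrite (@derive_val _ _ _ _ _ _ _ (is_derive_xu_form _ _ _ _ _)).
by rewrite /= mulr1 big1 ?add0r // => i _; rewrite mxE mulr0.
Qed.

(** For an affine field the second-order terms of [prolong_monge_ampere] vanish, and with xi
    independent of [u] only N m - 2 tr B remains. *)
Lemma affine_field_symmetry (M : set (xuspace R N))
    (v : xuspace R N -> xuspace R N)
    (B : 'I_N -> 'I_N -> R) (b : 'I_N -> R) (m : R) (c : 'I_N -> R) (d : R) :
  (forall p i, (v p).1 i 0 = xu_form (B i) 0 (b i) p) ->
  (forall p, (v p).2 = xu_form c m d p) ->
  N%:R * m = 2 * \sum_i B i i ->
  symmetry_generator 2 (monge_ampere R N) M v.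
Proof.
move=> v1 v2 trB z _ Fz.
have E1 i : (fun p => (v p).1 i 0) = xu_form (B i) 0 (b i).
  by apply/funext => p; rewrite v1.
have E2 : (fun p => (v p).2) = xu_form c m d by apply/funext => p; rewrite v2.
have det1 : \det (jet_hessian z) = 1.
  by move/eqP: Fz; rewrite /monge_ampere subr_eq0 => /eqP.
have S1 i : smooth_on setT (fun p => (v p).1 i 0) by rewrite E1; exact: xu_form_smooth.
have S2 : smooth_on setT (fun p => (v p).2) by rewrite E2; exact: xu_form_smooth.
rewrite (prolong_monge_ampere openT S2 S1) //.
have T0 c' m' k' a a' : totalD2_xu (xu_form c' m' k') a a' z = 0.
  rewrite /totalD2_xu !dx_xu_form !du_xu_form !dx_cst !du_cst.
  by rewrite !(mulr0, addr0).
rewrite E2 du_xu_form [X in X + _ - _]big1 => [|a _]; last first.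
  rewrite big1 // => a' _; rewrite T0 big1 ?subr0 ?mulr0 // => i _.
  by rewrite E1 T0 mul0r.
rewrite add0r big1 => [|i _]; last by rewrite E1 du_xu_form mul0r.
rewrite subr0 trB; apply/eqP; rewrite subr_eq0; apply/eqP; congr (_ * _).
apply: eq_bigr => i _.
by rewrite /totalD1_xu E1 dx_xu_form du_xu_form mulr0 addr0.
Qed.

End AffineSymmetries.

Section GlobalActions.
Variables (R : realType) (N : nat).
Implicit Types (a : R -> xuspace R N -> xuspace R N) (p : xuspace R N).

Lemma smooth_scale (U W : normedModType R) (f : U -> R) (w : W) :
  smooth_on setT f -> smooth_on setT (fun z => f z *: w).
Proof.
apply: (@smooth_linear_apply _ _ R W _ (fun k : R => k *: w)).
- by move=> k x y; rewrite scalerDl scalerA.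
- exact: scalel_continuous.
- exact: openT.
Qed.

Lemma smooth_components (U : normedModType R) (F : U -> xuspace R N) :
  (forall i, smooth_on setT (fun z => (F z).1 i 0)) ->
  smooth_on setT (fun z => (F z).2) -> smooth_on setT F.
Proof.
move=> F1 F2.
apply: (@smooth_eq _ _ _ _ (fun z => \sum_i (F z).1 i 0 *: ex R i + (F z).2 *: eu R N)).
- exact: openT.
- by move=> z _; rewrite [RHS]xu_decomp.
- apply: smooth_add; first exact: openT.
    by apply: smooth_sum => i; exact: (smooth_scale _ (F1 i)).
  exact: (smooth_scale _ F2).
Qed.

Lemma smooth_comp_fst (U W : normedModType R) (g : R -> W) :
  smooth_on setT g -> smooth_on setT (fun z : (R * U)%type => g z.1).
Proof.
have ll : linear (fun z : (R * U)%type => z.1 : R) by move=> k x y.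
pose lM := GRing.isLinear.Build _ _ _ _ _ ll.
pose L : {linear _ -> _} := HB.pack (fun z : (R * U)%type => z.1) lM.
by apply: (@smooth_comp_linear _ _ _ L) => x; exact: cvg_fst.
Qed.

Lemma global_local_action a :
  smooth_on setT (fun z : R * xuspace R N => a z.1 z.2) ->
  (forall p, a 0 p = p) -> (forall d e p, a d (a e p) = a (d + e) p) ->
  local_action (global_oneparam a).
Proof.
move=> sa a0 aD; split=> //=; exact: openT.
Qed.

Lemma global_symmetry a (B : 'I_N -> 'I_N -> R) (b : 'I_N -> R) (m : R)
    (c : 'I_N -> R) (d : R) :
  smooth_on setT (fun z : R * xuspace R N => a z.1 z.2) ->
  (forall p, a 0 p = p) -> (forall d e p, a d (a e p) = a (d + e) p) ->
  (forall p i, is_derive (0 : R) (1 : R) (fun e => (a e p).1 i 0)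
                 (xu_form (B i) 0 (b i) p)) ->
  (forall p, is_derive (0 : R) (1 : R) (fun e => (a e p).2) (xu_form c m d p)) ->
  N%:R * m = 2 * \sum_i B i i ->
  oneparam_symmetry 2 (monge_ampere R N) (global_oneparam a).
Proof.
move=> sa a0 aD d1 d2 trB; have GA := global_local_action sa a0 aD.
split=> //; apply: affine_field_symmetry trB => [p i|p].
- have Hg := is_derive_generator GA (I : carrier (global_oneparam a) p).
  have H := is_derive_coord i 0 (is_derive_fst Hg).
  by rewrite -(@derive_val _ _ _ _ _ _ _ H) (@derive_val _ _ _ _ _ _ _ (d1 p i)).
- have Hg := is_derive_generator GA (I : carrier (global_oneparam a) p).
  have H := is_derive_snd Hg.
  by rewrite -(@derive_val _ _ _ _ _ _ _ H) (@derive_val _ _ _ _ _ _ _ (d2 p)).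
Qed.

End GlobalActions.

(** * The listed transformations are symmetries *)

Section Generators.
Variables (R : realType) (N : nat).

Let smt : smooth_on setT (fun z : R * xuspace R N => z.1).
Proof. exact: (smooth_fst openT (@smooth_id _ _)). Qed.

Let smx i : smooth_on setT (fun z : R * xuspace R N => z.2.1 i 0).
Proof.
exact: (smooth_coord _ _ openT (smooth_fst openT (smooth_snd openT (@smooth_id _ _)))).
Qed.

Let smu : smooth_on setT (fun z : R * xuspace R N => z.2.2).
Proof. exact: (smooth_snd openT (smooth_snd openT (@smooth_id _ _))). Qed.

Let smooth_ext (U V : normedModType R) (f g : U -> V) :
  f =1 g -> smooth_on setT f -> smooth_on setT g.
Proof. by move=> /funext ->. Qed.

Lemma is_derive_affine_line (k l : R) (x : R) :
  is_derive x (1 : R) (fun e => k + e * l) l.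
Proof.
have := is_derive_add (is_derive_cst k x (1 : R))
  (is_derive_mul (is_derive_id x (1 : R)) (is_derive_cst l x (1 : R))).
by rewrite mulr0 mul1r !add0r.
Qed.

Let xu_form0 (b : R) p : @xu_form R N (fun=> 0) 0 b p = b.
Proof. by rewrite /xu_form big1 ?mul0r ?add0r // => i _; rewrite mul0r. Qed.

Lemma g1_symmetry (i : 'I_N) : oneparam_symmetry 2 (monge_ampere R N)
  (global_oneparam (fun e p => (p.1 + e *: delta_mx i 0, p.2))).
Proof.
apply: (@global_symmetry R N _ (fun _ _ => 0) (fun j => (j == i)%:R) 0 (fun=> 0) 0).
- apply: smooth_components => [j|]; last exact: smu.
  apply: (@smooth_ext _ _ (fun z : R * xuspace R N => z.2.1 j 0 + z.1 * (j == i)%:R)).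
    by move=> z /=; rewrite !mxE eqxx andbT.
  apply: smooth_add; [exact: openT | exact: smx |].
  by apply: smooth_mul; [exact: smt | exact: smooth_cst].
- by move=> [x u] /=; rewrite scale0r addr0.
- by move=> d e [x u] /=; rewrite scalerDl addrAC addrA.
- move=> p j /=; rewrite xu_form0.
  under eq_fun do rewrite !mxE eqxx andbT.
  exact: is_derive_affine_line.
- by move=> p /=; rewrite xu_form0; exact: is_derive_cst.
- by rewrite big1 ?mulr0.
Qed.

Lemma g2_symmetry : oneparam_symmetry 2 (monge_ampere R N)
  (global_oneparam (fun e p => (p.1, p.2 + e))).
Proof.
apply: (@global_symmetry R N _ (fun _ _ => 0) (fun=> 0) 0 (fun=> 0) 1).
- apply: smooth_components => [j|]; first exact: smx.
  by apply: smooth_add; [exact: openT | exact: smu | exact: smt].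
- by move=> [x u] /=; rewrite addr0.
- by move=> d e [x u] /=; rewrite -addrA [e + d]addrC.
- by move=> p j /=; rewrite xu_form0; exact: is_derive_cst.
- move=> p /=; rewrite xu_form0.
  have := is_derive_affine_line p.2 1 0; congr is_derive.
  by apply/funext => e; rewrite mulr1.
- by rewrite big1 ?mulr0.
Qed.

Lemma g3_symmetry (i : 'I_N) : oneparam_symmetry 2 (monge_ampere R N)
  (global_oneparam (fun e p => (p.1, p.2 + e * p.1 i 0))).
Proof.
apply: (@global_symmetry R N _ (fun _ _ => 0) (fun=> 0) 0 (fun j => (j == i)%:R) 0).
- apply: smooth_components => [j|]; first exact: smx.
  apply: smooth_add; [exact: openT | exact: smu |].
  by apply: smooth_mul; [exact: smt | exact: smx].
- by move=> [x u] /=; rewrite mul0r addr0.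
- by move=> d e [x u] /=; rewrite mulrDl addrAC addrA.
- by move=> p j /=; rewrite xu_form0; exact: is_derive_cst.
- move=> p /=; rewrite /xu_form mul0r !addr0 (bigD1 i) //= eqxx mul1r big1.
    by rewrite addr0; exact: is_derive_affine_line.
  by move=> j /negbTE ->; rewrite mul0r.
- by rewrite big1 ?mulr0.
Qed.

Lemma SL_oneparam0 (A : R -> 'M[R]_N) : SL_oneparam_subgroup A -> A 0 = 1%:M.
Proof.
move=> [_ AD A1].
have Au : A 0 \in unitmx by rewrite unitmxE A1 unitr1.
have := AD 0 0; rewrite addr0 => /(congr1 (mulmx (invmx (A 0)))).
by rewrite mulKmx // mulVmx.
Qed.

(** Differentiate det A = 1 at 0, where the cofactor matrix is the identity. *)
Lemma SL_oneparam_tr (A : R -> 'M[R]_N) : SL_oneparam_subgroup A ->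
  \tr ('D_1 A (0 : R)) = 0.
Proof.
move=> HA; have [As AD A1] := HA; have A0 := SL_oneparam0 HA.
have dA i j : is_derive (0 : R) 1 (fun e => A e i j) (('D_1 A (0 : R)) i j).
  exact: (is_derive_coord _ _ (smooth_is_derive (1 : R) As I)).
have := is_derive_det dA.
have -> : (fun t => \det (A t)) = cst 1 by apply/funext => t; rewrite A1.
move=> /(@derive_val _ _ _ _ _ _ _); rewrite derive_cst => E.
rewrite [RHS]E; apply: eq_bigr => i _.
have cof1 j : cofactor (A 0) i j = (j == i)%:R.
  have := congr1 (fun X : 'M[R]_N => X j i) (mul_mx_adj (A 0)).
  by rewrite {1}A0 mul1mx A1 [\adj _ _ _]mxE mxE.
rewrite (bigD1 i) //= cof1 eqxx mulr1 big1 ?addr0 // => j /negbTE ji.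
by rewrite cof1 ji mulr0.
Qed.

Lemma g4_symmetry (A : R -> 'M[R]_N) : SL_oneparam_subgroup A ->
  oneparam_symmetry 2 (monge_ampere R N) (global_oneparam (fun e p => (A e *m p.1, p.2))).
Proof.
move=> HA; have [As AD A1] := HA.
pose B : 'M[R]_N := 'D_1 A (0 : R).
apply: (@global_symmetry R N _ B (fun=> 0) 0 (fun=> 0) 0).
- apply: smooth_components => [j|]; last exact: smu.
  apply: (@smooth_ext _ _ (fun z : R * xuspace R N => \sum_k A z.1 j k * z.2.1 k 0)).
    by move=> z /=; rewrite mxE.
  apply: smooth_sum => k; apply: smooth_mul; last exact: smx.
  exact: (smooth_comp_fst (smooth_coord j k openT As)).
- by move=> [x u] /=; rewrite SL_oneparam0 // mul1mx.
- by move=> d e [x u] /=; rewrite AD mulmxA.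
- move=> p j /=; rewrite /xu_form mul0r !addr0.
  under eq_fun do rewrite mxE.
  apply: is_derive_bigsum => k _.
  have dA := is_derive_coord j k (smooth_is_derive (1 : R) As (I : setT 0)).
  have := is_derive_mul dA (is_derive_cst (p.1 k 0) (0 : R) (1 : R)).
  by rewrite mulr0 add0r.
- by move=> p /=; rewrite xu_form0; exact: is_derive_cst.
- by rewrite mulr0 -/(\tr B) SL_oneparam_tr ?mulr0.
Qed.

Lemma g5_symmetry (i : 'I_N) : oneparam_symmetry 2 (monge_ampere R N)
  (global_oneparam (fun e p =>
    (\col_j (if j == i then expR (N%:R * e) * p.1 j 0 else p.1 j 0),
     expR (2 * e) * p.2))).
Proof.
have dexp (k x : R) : is_derive (0 : R) (1 : R) (fun e => expR (k * e) * x) (k * x).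
  have := is_derive_mul (is_derive_expR_line k 0) (is_derive_cst x (0 : R) (1 : R)).
  by rewrite mulr0 add0r mulr0 expR0 mulr1.
(* The generator has B = N E_ii and m = 2, so the trace relation reads N * 2 = 2 * N; this is why
   the exponents are N and 2. *)
apply: (@global_symmetry R N _ (fun j k => ((j == i) && (k == i))%:R * N%:R)
   (fun=> 0) 2 (fun=> 0) 0).
- apply: smooth_components => [j|].
    apply: (@smooth_ext _ _ (fun z : R * xuspace R N =>
      if j == i then expR (N%:R * z.1) * z.2.1 j 0 else z.2.1 j 0)).
      by move=> z /=; rewrite mxE.
    case: (j == i); last exact: smx.
    by apply: smooth_mul; [exact: (smooth_comp_fst (smooth_exp _)) | exact: smx].
  by apply: smooth_mul; [exact: (smooth_comp_fst (smooth_exp _)) | exact: smu].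
- move=> [x u] /=; rewrite !mulr0 expR0 !mul1r; congr pair.
  by apply/matrixP => j k; rewrite mxE ord1 mul1r; case: ifP.
- move=> d e [x u] /=; rewrite !mulrDr !expRD !mulrA; congr pair.
  apply/matrixP => j k; rewrite !mxE; case: (j == i) => //.
  by rewrite mulrA.
- move=> p j /=; rewrite /xu_form mul0r !addr0.
  under eq_fun do rewrite mxE.
  have [->|ji] := eqVneq j i; last first.
    by rewrite big1 => [|k _]; [exact: is_derive_cst | rewrite !mul0r].
  rewrite (bigD1 i) //= eqxx mul1r big1 ?addr0 => [|k /negbTE ->]; last by rewrite !mul0r.
  exact: dexp.
- move=> p /=; rewrite /xu_form big1 ?add0r ?addr0 => [|k _]; first exact: dexp.
  by rewrite mul0r.
- rewrite mulrC (bigD1 i) //= eqxx mul1r big1 ?addr0 // => k /negbTE ->.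
  by rewrite mul0r.
Qed.

Lemma MA_transformations_symmetry (G : oneparam R N) :
  MA_transformations R N G -> oneparam_symmetry 2 (monge_ampere R N) G.
Proof.
case=> [i||i|A|i]; [exact: g1_symmetry|exact: g2_symmetry|exact: g3_symmetry| |].
  exact: g4_symmetry.
exact: g5_symmetry.
Qed.

End Generators.

Lemma local_group_mono (R : realType) (N : nat) (S S' : oneparam R N -> Prop) p T :
  (forall G, S G -> S' G) -> local_group S p T -> local_group S' p T.
Proof.
move=> SS'; elim=> {T}[T|G e T T' SG _ IH dT HT']; first exact: local_group_id.
exact: local_group_comp (SS' G SG) IH dT HT'.
Qed.

Lemma symmetry_group_affine (R : realType) (N : nat) (p : xuspace R N) T :
  (1 < N)%N -> symmetry_group 2 (monge_ampere R N) p T ->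
  exists2 L, MA_affine L & \forall q \near p, T q = L q.
Proof.
move=> N1; elim=> {T}[T TE|G e T T' SG _ [L ML TL] dT HT'].
  by exists id; first exact: MA_affine_id.
have [L' ML' HL'] := flow_locally_affine N1 SG dT.
exists (L' \o L); first exact: MA_affine_comp.
(* [T p] equals [L p], so continuity of [L] pulls the neighbourhood of [T p] back to one of [p]. *)
rewrite (nbhs_singleton TL) in HL'.
have := MA_affine_continuous ML HL' => HL.
near=> q.
have -> : T' q = act G e (T q) by near: q.
have -> : T q = L q by near: q.
by rewrite /=; near: q.
Unshelve. all: by end_near. Qed.

(* For N = 1 the second inclusion fails: u'' = 1 also admits the symmetry
   generated by (u - x^2/2) d/du. *)
Theorem theorem1p1 (R : realType) (N : nat) (N_gt0 : (0 < N)%N) :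
  (forall (p : xuspace R N) (T : xuspace R N -> xuspace R N),
     local_group (MA_transformations R N) p T ->
     symmetry_group 2 (monge_ampere R N) p T) /\
  ((1 < N)%N ->
   forall (p : xuspace R N) (T : xuspace R N -> xuspace R N),
     symmetry_group 2 (monge_ampere R N) p T ->
     local_group (MA_transformations R N) p T).
Proof.
split=> [p T|N1 p T /(symmetry_group_affine N1)[L ML TL]].
  by apply: local_group_mono => G; exact: MA_transformations_symmetry.
exact: MA_affine_local_group TL.
Qed.
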